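(* Let $X$ be a proper CAT$(-1)$ space, let $\Gamma\le\operatorname{Isom}(X)$ be finitely generated, non-elementary and discrete with $0<\delta_X(\Gamma)<\infty$, let $A,B\in\Lambda_\Gamma$ be distinct and $o$ a point on the geodesic $(A,B)$. Let $H\le\Gamma$ be the fundamental group of a finite connected graph of groups $\mathcal G$, let $C\in\mathscr C$ be one of its blocks, and fix a finite choice of hyperbolic representatives in $C$. Suppose that, for each retained transition $e\to f$, there are $N_{ef}$ selected distinct cosets and every chosen representative $g_{ef,c}$ satisfies $a_o(g_{ef,c})\le R_{ef}$. Set $B_{ef}(s)=N_{ef}e^{-sR_{ef}}$ (with $N_{ef}=B_{ef}=0$ when nothing is selected for $e\to f$). Then $$\rho(B(\delta_X(\Gamma)))\le1.$$ If $R_{ef}\le R$ for every retained transition and $N=(N_{ef})$, then $$\delta_X(\Gamma)\,R\ge\log\rho(N)\qquad\text{whenever }\rho(N)>1.$$ Along a directed cycle whose successive retained transition multiplicities are $N_j$ and whose corresponding upper bounds for $a_o(g)$ are $R_j$, $$\delta_X(\Gamma)\sum_jR_j\ge\sum_j\log N_j.$$ If $\delta_X(\Gamma)<1$, or if the action of $\Gamma$ is convex-cobounded, the right-hand sides give lower bounds for $\dim_H(\Lambda_\Gamma)$ (that is, $\delta_X(\Gamma)$ may be replaced by $\dim_H(\Lambda_\Gamma,\rho_o)$ in the two preceding inequalities) at every level of every chosen finite Grushko–JSJ hierarchy.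
   Context: $\delta_X(\Gamma)=\inf\{s>0:\sum_{g\in\Gamma}e^{-sd(o,go)}<\infty\}$; $\Lambda_\Gamma$ is the limit set; $\rho_o(\xi,\eta)=e^{-(\xi\mid\eta)_o}$ is the Bourdon metric on $\partial X$; $\dim_H$ is Hausdorff dimension; $\rho(M)$ is the spectral radius of a matrix $M$. The action is convex-cobounded if there is $R'<\infty$ with $\bigcup_{g,h\in\Gamma}[go,ho]\subseteq\bigcup_{g\in\Gamma}gB_X(o,R')$. A finite graph-of-groups hierarchy is a finite rooted tree of subgroups of $\Gamma$ in which every nonterminal node carries a finite graph-of-groups decomposition and selected vertex groups become its children; a Grushko–JSJ hierarchy is one rooted at $\Gamma$ whose decompositions are a Grushko decomposition at the root, finite (relative) JSJ decompositions, and finitely many further relative splittings. ''At every level'' means that the inequalities $\dim_H(\Lambda_\Gamma,\rho_o)\,R\ge\log\rho(N)$ (whenever $\rho(N)>1$ and $R_{ef}\le R$ for every retained transition) and $\dim_H(\Lambda_\Gamma,\rho_o)\sum_jR_j\ge\sum_j\log N_j$ (along a directed cycle of retained transitions) hold when $(H,\mathcal G)$ is any nonterminal node of the hierarchy with its decomposition, and the block $C$, the finite choice of hyperbolic representatives, and the numbers $N_{ef},R_{ef},R,N_j,R_j$ are those attached to that $(H,\mathcal G)$. Data attached to $(H,\mathcal G)$. $\mathcal G$ has finite underlying graph $Y$ and Bass–Serre tree $T$ ($H$ acts without inversions, $H\backslash T=Y$). For an oriented edge $f$ of $Y$: origin $\iota(f)$, terminus $t(f)$, reverse $\bar f$. Fix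 a base vertex $v_*$ of $Y$, a lift $\tilde v\in T$ of each vertex $v$, a lift $\tilde f$ of each oriented edge $f$ with origin $\widetilde{\iota(f)}$, and $\tau_f\in H$ with $t(\tilde f)=\tau_f\widetilde{t(f)}$, chosen so that $\widetilde{\bar f}=\tau_f^{-1}\overline{\tilde f}$ and $\tau_{\bar f}=\tau_f^{-1}$. Put $G_v=\operatorname{Stab}_H(\tilde v)$, $G_f=\operatorname{Stab}_H(\tilde f)\le G_{\iota(f)}$. An allowed transition is a triple $(e,f,c)$ of oriented edges $e,f$ with $t(e)=\iota(f)$ and $c\in G_{\iota(f)}/G_f$, where $c\ne G_f$ is required if $f=\bar e$. A reduced coset-labelled loop based at $v_*$ is a sequence $(f_1,c_1;\dots;f_n,c_n)$, $c_j\in G_{\iota(f_j)}/G_{f_j}$, with $\iota(f_1)=v_*=t(f_n)$ and all $(f_j,f_{j+1},c_{j+1})$ allowed. $E_*$ is the set of oriented edges occurring in some such loop; the support digraph on $E_*$ has an arrow $e\to f$ when some $(e,f,c)$ is allowed; $\mathscr C$ is the set of its strongly connected components containing a directed closed walk of positive length. An isometry $g$ is hyperbolic if $\tau_X(g)=\inf_zd(z,gz)$ is positive and attained; it has a unique axis $\operatorname{Ax}(g)$, and $a_o(g)=\tau_X(g)+2d(o,\operatorname{Ax}(g))$. A finite choice of hyperbolic representatives in $C$ consists, for each $e,f\in C$, of a finite set $\mathcal F_{ef}$ of distinct (selected) cosets $c$ with $(e,f,c)$ allowed and, for each $c=rG_f\in\mathcal F_{ef}$, one hyperbolic element $g_{ef,c}=rh\tau_f$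 with $h\in G_f$. The transition $e\to f$ is retained if $\mathcal F_{ef}\ne\varnothing$. *)

(* Defs.v *)
From HB Require Import structures.
From mathcomp Require Import all_boot all_order all_algebra finmap.
From mathcomp Require Import complex.
From mathcomp Require Import all_classical all_reals all_analysis.

Set Implicit Arguments.
Unset Strict Implicit.
Unset Printing Implicit Defensive.

Import Order.TTheory GRing.Theory Num.Theory.
Import numFieldNormedType.Exports.

Local Open Scope classical_set_scope.
Local Open Scope ring_scope.

Section Geodesics.
Context {R : realType} {X : metricType R}.
Implicit Types (x y z o : X) (c : R -> X).

(* Only the restriction of [c] to [0, l] matters. *)
Definition geodesic_path c (l : R) x y : Prop :=
  [/\ 0 <= l, c 0 = x, c l = y &
      forall s t, 0 <= s <= l -> 0 <= t <= l -> mdist (c s) (c t) = `|s - t|].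

Definition segment x y : set X :=
  [set z | exists c l t, geodesic_path c l x y /\ 0 <= t <= l /\ z = c t].

(* Only the restriction of [c] to [0, +oo[ matters. *)
Definition geodesic_ray c : Prop :=
  forall s t, 0 <= s -> 0 <= t -> mdist (c s) (c t) = `|s - t|.

Definition geodesic_line c : Prop :=
  forall s t, mdist (c s) (c t) = `|s - t|.

Definition asymptotic c c' : Prop :=
  exists M : R, forall t, 0 <= t -> mdist (c t) (c' t) <= M.

Definition gromov_product o x y : R :=
  (mdist x o + mdist y o - mdist x y) / 2.

End Geodesics.

Definition proper_space {R : realType} (X : metricType R) : Prop :=
  forall (x : X) (r : R), compact [set y | mdist x y <= r].

Definition geodesic_space {R : realType} (X : metricType R) : Prop :=
  forall x y : X, exists c l, geodesic_path c l x y.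

(* The hyperbolic plane as the upper sheet of the hyperboloid
   x0^2 - x1^2 - x2^2 = 1, parametrised by (x1, x2). *)
Section HyperbolicPlane.
Context {R : realType}.
Implicit Types p q : R * R.

Definition arcosh (t : R) : R := ln (t + Num.sqrt (t ^+ 2 - 1)).

Definition hyp_height p : R := Num.sqrt (1 + p.1 ^+ 2 + p.2 ^+ 2).

Definition hyp_dist p q : R :=
  arcosh (hyp_height p * hyp_height q - p.1 * q.1 - p.2 * q.2).

End HyperbolicPlane.

(* Comparison with triangles of constant curvature -1.  Two points on sides of
   a geodesic triangle always lie on two sides issuing from a common vertex x;
   [p'] and [q'] are their comparison points. *)
Definition cat_minus_one {R : realType} (X : metricType R) : Prop :=
  geodesic_space X /\
  forall (x y z : X) (a b : R -> X) (la lb s t : R) (x' y' z' p' q' : R * R),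
    geodesic_path a la x y -> geodesic_path b lb x z ->
    hyp_dist x' y' = mdist x y -> hyp_dist x' z' = mdist x z ->
    hyp_dist y' z' = mdist y z ->
    0 <= s <= la -> 0 <= t <= lb ->
    hyp_dist x' p' = s -> hyp_dist p' y' = la - s ->
    hyp_dist x' q' = t -> hyp_dist q' z' = lb - t ->
    mdist (a s) (b t) <= hyp_dist p' q'.

(* Points are asymptoty classes of geodesic rays. *)
Record boundary {R : realType} (X : metricType R) := Boundary {
  bclass : set (R -> X);
  bclassP : exists c, geodesic_ray c /\
    bclass = [set c' | geodesic_ray c' /\ asymptotic c c'] }.

Section Boundary.
Context {R : realType} {X : metricType R}.
Implicit Types (xi eta : boundary X) (o : X).

Definition bray xi : R -> X := projT1 (cid (bclassP xi)).

(* In a CAT(-1) space the limit exists and does not depend on the rays chosen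
   in the classes; it is +oo when xi = eta. *)
Definition boundary_gromov_product o xi eta : \bar R :=
  lim ((gromov_product o (bray xi t) (bray eta t))%:E @[t --> +oo]).

Definition bourdon_metric o xi eta : R :=
  fine (expeR (- boundary_gromov_product o xi eta)%E).

(* Trace on X of a basic neighbourhood of xi for the cone topology. *)
Definition cone_nbhd o xi (r eps : R) : set X :=
  [set x | exists c, [/\ bclass xi c, c 0 = o &
    exists a l, [/\ geodesic_path a l o x, r < l & mdist (a r) (c r) < eps]]].

Definition on_geodesic (A B : boundary X) o : Prop :=
  exists c t, [/\ geodesic_line c, bclass A (fun s => c (- s)),
                  bclass B c & o = c t].

End Boundary.

Section HausdorffDimension.
Context {R : realType} {T : Type} (rho : T -> T -> R).
Local Open Scope ereal_scope.

(* The empty set has diameter 0. *)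
Definition diameter (U : set T) : \bar R :=
  ereal_sup ([set 0] `|` [set (rho x y)%:E | x in U & y in U]).

Definition hausdorff_premeasure (s eps : R) (A : set T) : \bar R :=
  ereal_inf [set \sum_(0 <= n <oo) (diameter (U n)) `^ s | U in
    [set U : nat -> set T | A `<=` \bigcup_n U n /\
                            forall n, diameter (U n) <= eps%:E]].

Definition hausdorff_measure (s : R) (A : set T) : \bar R :=
  ereal_sup [set hausdorff_premeasure s eps A | eps in [set e : R | (0 < e)%R]].

Definition hausdorff_dim (A : set T) : \bar R :=
  ereal_inf [set s%:E | s in
    [set s : R | (0 < s)%R /\ hausdorff_measure s A = 0]].

End HausdorffDimension.

Section Subgroups.
Context {G : groupType}.
Implicit Types (H K A B : set G).
Local Open Scope group_scope.

Definition is_subgroup H : Prop :=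
  [/\ H 1, forall g h, H g -> H h -> H (g * h) & forall g, H g -> H g^-1].

Definition generated (S : set G) : set G :=
  [set g | forall K, is_subgroup K -> S `<=` K -> K g].

Definition finitely_generated H : Prop :=
  exists2 S : set G, finite_set S & H = generated S.

Definition left_coset (r : G) H : set G := [set r * h | h in H].

Definition conj_subgroup H (g : G) : set G := [set g * h * g^-1 | h in H].

(* An alternating word in A and B: the boolean tells the factor to which the
   letter belongs. *)
Definition alternating_word A B (w : seq (bool * G)) : Prop :=
  (forall x, x \in w -> x.2 <> 1 /\ (if x.1 then A else B) x.2) /\
  sorted (fun x y => x.1 != y.1) w.

Definition internal_free_product K A B : Prop :=
  [/\ is_subgroup A, is_subgroup B, K = generated (A `|` B) &
      forall w, alternating_word A B w -> w <> [::] ->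
        foldr (fun x g => x.2 * g) 1 w <> 1].

Definition freely_indecomposable K : Prop :=
  forall A B, internal_free_product K A B -> A = [set 1] \/ B = [set 1].

End Subgroups.

Record isom {R : realType} (X : metricType R) := Isom {
  isom_fun :> X -> X;
  isom_inv : X -> X;
  isomK : cancel isom_fun isom_inv;
  isomVK : cancel isom_inv isom_fun;
  isom_dist : forall x y, mdist (isom_fun x) (isom_fun y) = mdist x y }.

Section IsomGroup.
Context {R : realType} {X : metricType R}.
Implicit Types g h k : isom X.

Lemma isom_ext g h : isom_fun g =1 isom_fun h -> g = h.
Proof.
case: g h => [f f' fK f'K df] [k k' kK k'K dk] /= /funext fk.
move: fK f'K df; rewrite fk => fK f'K df.
have ff' : f' = k' by apply/funext => x; rewrite -{1}[x]k'K fK.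
move: fK f'K; rewrite ff' => fK f'K.
by congr Isom; exact: Prop_irrelevance.
Qed.

HB.instance Definition _ := gen_eqMixin (isom X).
HB.instance Definition _ := gen_choiceMixin (isom X).

Definition isom_one : isom X :=
  @Isom R X id id (frefl id) (frefl id) (fun _ _ => erefl).

Lemma isom_mul_dist g h x y : mdist (g (h x)) (g (h y)) = mdist x y.
Proof. by rewrite !isom_dist. Qed.

Definition isom_mul g h : isom X :=
  @Isom R X (g \o h) (isom_inv h \o isom_inv g)
    (can_comp (@isomK _ _ g) (@isomK _ _ h))
    (can_comp (@isomVK _ _ h) (@isomVK _ _ g))
    (isom_mul_dist g h).

Lemma isom_inv_dist g x y : mdist (isom_inv g x) (isom_inv g y) = mdist x y.
Proof. by rewrite -(isom_dist g) !isomVK. Qed.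

Definition isom_opp g : isom X :=
  @Isom R X (isom_inv g) g (@isomVK _ _ g) (@isomK _ _ g) (isom_inv_dist g).

Lemma isom_mulA : associative isom_mul.
Proof. by move=> g h k; exact: isom_ext. Qed.

Lemma isom_mul1g : left_id isom_one isom_mul.
Proof. by move=> g; exact: isom_ext. Qed.

Lemma isom_mulg1 : right_id isom_one isom_mul.
Proof. by move=> g; exact: isom_ext. Qed.

Lemma isom_mulVg : left_inverse isom_one isom_opp isom_mul.
Proof. by move=> g; apply: isom_ext => x /=; rewrite isomK. Qed.

Lemma isom_mulgV : right_inverse isom_one isom_opp isom_mul.
Proof. by move=> g; apply: isom_ext => x /=; rewrite isomVK. Qed.

HB.instance Definition _ := isGroup.Build (isom X)
  isom_mulA isom_mul1g isom_mulg1 isom_mulVg isom_mulgV.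

End IsomGroup.

Section IsometryGroups.
Context {R : realType} {X : metricType R}.
Implicit Types (Gam : set (isom X)) (g : isom X) (o : X).

(* Discreteness for the compact-open topology on Isom(X). *)
Definition discrete_group Gam : Prop :=
  forall g, Gam g -> exists (K : set X) (eps : R),
    [/\ compact K, 0 < eps &
      forall h, Gam h -> (forall x, K x -> mdist (g x) (h x) < eps) -> h = g].

Definition critical_exponent Gam o : \bar R :=
  ereal_inf [set s%:E | s in [set s : R | 0 < s /\
    (\esum_(g in Gam) (expR (- (s * mdist o (g o))))%:E < +oo)%E]].

Definition limit_set Gam o : set (boundary X) :=
  [set xi | forall r eps : R, 0 <= r -> 0 < eps ->
    exists2 g, Gam g & cone_nbhd o xi r eps (g o)].

(* At least three limit points; for discrete groups the limit set is then
   infinite. *)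
Definition non_elementary Gam o : Prop :=
  forall xi eta, ~ (limit_set Gam o `<=` [set xi; eta]).

Definition convex_cobounded Gam o : Prop :=
  exists r : R, forall g h, Gam g -> Gam h ->
    segment (g o) (h o) `<=` \bigcup_(k in Gam) [set k x | x in ball o r].

Definition translation_length g : R := inf [set mdist z (g z) | z in setT].

Definition hyperbolic g : Prop :=
  0 < translation_length g /\ exists z, mdist z (g z) = translation_length g.

(* Points on a geodesic line translated by g; a hyperbolic isometry of a
   CAT(-1) space has exactly one such line. *)
Definition axis g : set X :=
  [set z | exists c : R -> X, [/\ geodesic_line c,
    forall t, g (c t) = c (t + translation_length g) & exists t, z = c t]].

Definition axis_length o g : R :=
  translation_length g + 2 * inf [set mdist o z | z in axis g].

End IsometryGroups.

Record graph (V E : Type) := Graph {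
  org : E -> V;
  einv : E -> E;
  einvK : involutive einv;
  einv_neq : forall e, einv e <> e }.

Section Graphs.
Context {V E : Type} (Y : graph V E).

Definition ter (e : E) : V := org Y (einv Y e).

Fixpoint walk (u : V) (s : seq E) (v : V) : Prop :=
  if s is e :: s' then org Y e = u /\ walk (ter e) s' v else u = v.

Fixpoint no_backtrack (s : seq E) : Prop :=
  if s is e :: s' then
    (if s' is f :: _ then f <> einv Y e else True) /\ no_backtrack s'
  else True.

Definition is_tree : Prop :=
  [/\ exists v : V, True,
      forall u v, exists s, walk u s v &
      forall u s, walk u s u -> no_backtrack s -> s = [::]].

End Graphs.

(* Only the restriction of the action to H is meaningful. *)
Record tree_action (G : groupType) (H : set G) := TreeAction {
  tvert : Type;
  tedge : Type;
  tgraph : graph tvert tedge;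
  tgraph_tree : is_tree tgraph;
  actV : G -> tvert -> tvert;
  actE : G -> tedge -> tedge;
  actV1 : forall x, actV 1%g x = x;
  actE1 : forall e, actE 1%g e = e;
  actVM : forall g h x, H g -> H h -> actV (g * h)%g x = actV g (actV h x);
  actEM : forall g h e, H g -> H h -> actE (g * h)%g e = actE g (actE h e);
  act_org : forall g e, H g -> org tgraph (actE g e) = actV g (org tgraph e);
  act_einv : forall g e, H g ->
    einv tgraph (actE g e) = actE g (einv tgraph e);
  act_no_inversion : forall g e, H g -> actE g e <> einv tgraph e }.

Section TreeActions.
Context {G : groupType} {H : set G} (T : tree_action H).

Definition stabV (x : tvert T) : set G := H `&` [set g | actV g x = x].

Definition stabE (e : tedge T) : set G := H `&` [set g | actE g e = e].

Definition elliptic (K : set G) : Prop :=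
  exists x : tvert T, K `<=` stabV x.

End TreeActions.

(* A finite graph-of-groups decomposition of H, given through its Bass-Serre
   tree: Y is the quotient graph H\T, with projection (projV, projE). *)
Record gog (G : groupType) (H : set G) := Gog {
  bs_tree :> tree_action H;
  gvert : finType;
  gedge : finType;
  ggraph : graph gvert gedge;
  projV : tvert bs_tree -> gvert;
  projE : tedge bs_tree -> gedge;
  projV_surj : forall v, exists x, projV x = v;
  projE_surj : forall f, exists e, projE e = f;
  proj_org : forall e, projV (org (tgraph bs_tree) e) = org ggraph (projE e);
  proj_einv : forall e, projE (einv (tgraph bs_tree) e) = einv ggraph (projE e);
  projV_orbit : forall x y,
    projV x = projV y <-> exists2 h, H h & actV h x = y;
  projE_orbit : forall e f,
    projE e = projE f <-> exists2 h, H h & actE h e = f }.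

Record gog_lifts (G : groupType) (H : set G) (D : gog H) := GogLifts {
  base_vertex : gvert D;
  liftV : gvert D -> tvert D;
  liftE : gedge D -> tedge D;
  tau : gedge D -> G;
  liftVK : forall v, projV (liftV v) = v;
  liftEK : forall f, projE (liftE f) = f;
  liftE_org : forall f, org (tgraph D) (liftE f) = liftV (org (ggraph D) f);
  tau_in : forall f, H (tau f);
  tau_ter : forall f,
    ter (tgraph D) (liftE f) = actV (tau f) (liftV (ter (ggraph D) f));
  liftE_einv : forall f, liftE (einv (ggraph D) f) =
    actE (tau f)^-1%g (einv (tgraph D) (liftE f));
  tau_einv : forall f, tau (einv (ggraph D) f) = (tau f)^-1%g }.

Section Transitions.
Context {G : groupType} {H : set G} {D : gog H} (L : gog_lifts D).
Local Notation E := (gedge D).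
Local Notation Y := (ggraph D).

Definition vgroup (v : gvert D) : set G := stabV (liftV L v).

Definition egroup (f : E) : set G := stabE (liftE L f).

Definition is_coset (f : E) (c : set G) : Prop :=
  exists2 r, vgroup (org Y f) r & c = left_coset r (egroup f).

Definition allowed (e f : E) (c : set G) : Prop :=
  [/\ ter Y e = org Y f, is_coset f c & f = einv Y e -> c <> egroup f].

Fixpoint allowed_from (e : E) (s : seq (E * set G)) : Prop :=
  if s is (f, c) :: s' then allowed e f c /\ allowed_from f s' else True.

(* The loop (f_1, c_1; ...; f_n, c_n) is encoded as ((f1, c1), s). *)
Definition reduced_loop (f1 : E) (c1 : set G) (s : seq (E * set G)) : Prop :=
  [/\ org Y f1 = base_vertex L, is_coset f1 c1, allowed_from f1 s &
      ter Y (last f1 [seq x.1 | x <- s]) = base_vertex L].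

Definition loop_edges : {set E} :=
  [set e | `[< exists f1 c1 s, reduced_loop f1 c1 s /\
                 e \in f1 :: [seq x.1 | x <- s] >]]%SET.

Definition support_arrow : rel E := fun e f =>
  [&& e \in loop_edges, f \in loop_edges & `[< exists c, allowed e f c >]].

Definition is_block (C : {set E}) : Prop :=
  (exists2 e, e \in loop_edges &
     C = [set f in loop_edges |
            connect support_arrow e f && connect support_arrow f e]%SET) /\
  (exists w : seq E, [/\ w <> [::], {subset w <= C} & cycle support_arrow w]).

End Transitions.

Record hyp_choice {R : realType} {X : metricType R} {H : set (isom X)}
    {D : gog H} (L : gog_lifts D) (C : {set gedge D}) := HypChoice {
  selected : gedge D -> gedge D -> {fset (set (isom X))};
  hrep : gedge D -> gedge D -> set (isom X) -> isom X;
  selectedP : forall e f c, e \in C -> f \in C -> c \in selected e f ->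
    allowed L e f c;
  hrepP : forall e f c, e \in C -> f \in C -> c \in selected e f ->
    exists r h, [/\ vgroup L (org (ggraph D) f) r,
      c = left_coset r (egroup L f), egroup L f h &
      hrep e f c = (r * h * tau L f)%g];
  hrep_hyperbolic : forall e f c, e \in C -> f \in C -> c \in selected e f ->
    hyperbolic (hrep e f c) }.

Definition spectral_radius {R : realType} (n : nat) (M : 'M[R]_n) : R :=
  sup [set complex.Re `|z| | z in
    [set z : R[i] | eigenvalue (map_mx (real_complex R) M) z]].

Definition block_matrix {R : realType} {E : finType} (C : {set E})
    (M : E -> E -> R) : 'M[R]_#|C| :=
  \matrix_(i, j) M (enum_val i) (enum_val j).

Section Growth.
Context {R : realType} {X : metricType R} {H : set (isom X)} {D : gog H}.
Context {L : gog_lifts D} {C : {set gedge D}} (S : hyp_choice L C).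
Implicit Types (Rb : gedge D -> gedge D -> R).

Definition retained : rel (gedge D) := fun e f =>
  [&& e \in C, f \in C & selected S e f != fset0].

Definition nsel (e f : gedge D) : R := #|` selected S e f|%:R.

Definition length_bound (o : X) Rb : Prop :=
  forall e f c, retained e f -> c \in selected S e f ->
    axis_length o (hrep S e f c) <= Rb e f.

Definition rho_B Rb (s : R) : R :=
  spectral_radius
    (block_matrix C (fun e f => nsel e f * expR (- (s * Rb e f)))).

Definition rho_N : R := spectral_radius (block_matrix C nsel).

Definition uniform_bound Rb (kappa : \bar R) : Prop :=
  forall R0 : R, (forall e f, retained e f -> Rb e f <= R0) ->
    1 < rho_N -> ((ln rho_N)%:E <= kappa * R0%:E)%E.

(* A directed cycle is given by the list w of its successive edges; its
   transitions are the pairs of cyclically consecutive entries. *)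
Definition cycle_bound Rb (kappa : \bar R) : Prop :=
  forall w : seq (gedge D), w <> [::] -> cycle retained w ->
    ((\sum_(ef <- zip w (rot 1 w)) ln (nsel ef.1 ef.2))%:E <=
      kappa * (\sum_(ef <- zip w (rot 1 w)) Rb ef.1 ef.2)%:E)%E.

End Growth.

Section JSJ.
Context {G : groupType} {H : set G}.
Implicit Types (AA HH : set (set G)) (T : tree_action H).

(* Admissible edge groups: a family of subgroups of H closed under
   conjugation in H and under passing to subgroups. *)
Definition edge_class AA : Prop :=
  [/\ forall K, AA K -> is_subgroup K /\ K `<=` H,
      forall K g, AA K -> H g -> AA (conj_subgroup K g) &
      forall K K', AA K -> is_subgroup K' -> K' `<=` K -> AA K'].

Definition peripheral_family HH : Prop :=
  forall K, HH K -> is_subgroup K /\ K `<=` H.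

Definition relative_tree AA HH T : Prop :=
  (forall e : tedge T, AA (stabE e)) /\ (forall K, HH K -> elliptic T K).

Definition universally_elliptic AA HH T : Prop :=
  relative_tree AA HH T /\
  forall T', relative_tree AA HH T' ->
    forall e : tedge T, elliptic T' (stabE e).

Definition dominates T T' : Prop :=
  forall K, is_subgroup K -> elliptic T K -> elliptic T' K.

Definition jsj_tree AA HH T : Prop :=
  universally_elliptic AA HH T /\
  forall T', universally_elliptic AA HH T' -> dominates T T'.

Definition jsj_decomposition (D : gog H) : Prop :=
  exists AA HH, [/\ edge_class AA, peripheral_family HH & jsj_tree AA HH D].

Definition relative_splitting (D : gog H) : Prop :=
  exists AA HH, [/\ edge_class AA, peripheral_family HH & relative_tree AA HH D].

Definition grushko_decomposition (D : gog H) : Prop :=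
  (forall e : tedge D, stabE e = [set 1%g]) /\
  (forall x : tvert D, freely_indecomposable (stabV x)).

End JSJ.

(* Finite graph-of-groups hierarchies rooted at H.  The children of a node are
   the vertex groups of the selected vertices, realised as stabilisers of
   chosen lifts. *)
Inductive hierarchy (G : groupType) : set G -> Type :=
| HLeaf (H : set G) : hierarchy H
| HNode (H : set G) (D : gog H) (sel : {set gvert D})
    (x : gvert D -> tvert D) (xK : forall v, projV (x v) = v)
    (children : forall v, v \in sel -> hierarchy (stabV (x v))) :
    hierarchy H.

Fixpoint every_node (G : groupType) (P : forall H : set G, gog H -> Prop)
    (H : set G) (T : hierarchy H) : Prop :=
  match T with
  | HLeaf _ => True
  | HNode H D sel x _ children =>
      P H D /\ forall v (hv : v \in sel), every_node P (children v hv)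
  end.

Definition grushko_jsj (G : groupType) (H : set G) (T : hierarchy H) : Prop :=
  match T with
  | HLeaf _ => False
  | HNode H D sel x _ children =>
      grushko_decomposition D /\
      forall v (hv : v \in sel),
        every_node (fun H' D' => jsj_decomposition D' \/ relative_splitting D')
          (children v hv)
  end.

(* Main.v *)
From mathcomp Require Import all_boot all_order all_algebra finmap.
From mathcomp Require Import complex ring lra.
From mathcomp Require Import all_classical all_reals all_analysis.
Require Import Defs.

Set Implicit Arguments.
Unset Strict Implicit.
Unset Printing Implicit Defensive.

Import Order.TTheory GRing.Theory Num.Theory.
Import numFieldNormedType.Exports.

Local Open Scope classical_set_scope.
Local Open Scope ring_scope.

(** Fix a hyperbolic element [g] of [Gam] and write [|g|] for the displacement
    of the base point [o].  Sliding [o] to the axis of [g], along it, and back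
    gives [|g| <= axis_length o g] ([displacement_le_axis_length]); the axis
    exists because the displacement of the powers of [g] grows linearly
    ([double_displacement], [hyperbolic_axis]).

    Consider the products of the chosen representatives along the words of
    retained transitions.  Such a word traces out a path in the Bass-Serre tree;
    the condition on allowed transitions says exactly that this path is reduced,
    and reduced paths in a tree are determined by their ends.  Hence words with
    the same first and last edge have different products
    ([word_product_inj]), and the sum of [expR (- s * |g|)] over the products
    [g] of all words is at most a multiple of the Poincare series at [s].  Since
    [|g|] is at most the sum of the bounds [Rb] along the word, the entries of
    all powers of the matrix [B(s)] stay bounded when [s] exceeds the critical
    exponent [delta] ([path_mass_le]).  So its eigenvalues have modulus at most
    one ([spectral_radius_le]) and the product of its entries along a cycle is
    at most one ([cycle_product_le1]); letting [s] decrease to [delta] gives the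
    three bounds in terms of [delta].

    It remains to see that [delta] is at most the Hausdorff dimension of the
    limit set ([critical_exponent_le_dim]), after Bishop and Jones.  Negative
    curvature enters only through the four point inequality for Gromov products
    ([four_point]).  Given [s < delta], some annuli of the orbit contain many
    more than [expR (s * n)] points ([populated_annulus]).  Among them select
    elements which move [o] in nearly the same direction [q], whose inverses
    move [o] in nearly the same direction [q'], and which are far apart.  No
    boundary point is fixed by [Gam], so an element [m] of bounded displacement
    moves [q'] away from [q] ([visible_motion]); then the products [g m^-1]
    generate a free semigroup whose words label quasi-geodesics
    ([ping_pong_exists]).  The infinite words in it have limit points which are
    separated in the Bourdon metric according to the length of their common
    prefix ([word_limits_separated]), and a mass distribution argument shows
    that these points form a set of positive [s]-dimensional measure
    ([hausdorff_measure_coded_neq0]). *)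

(** * Hyperbolic trigonometry *)

Section HyperbolicFunctions.
Context {R : realType}.
Implicit Types a b c d s t u x y : R.

Definition ch x := (expR x + expR (- x)) / 2.
Definition sh x := (expR x - expR (- x)) / 2.

Lemma ch0 : ch 0 = 1.
Proof. by rewrite /ch oppr0 expR0; field. Qed.

Lemma sh0 : sh 0 = 0.
Proof. by rewrite /sh oppr0 subrr mul0r. Qed.

Lemma chN x : ch (- x) = ch x.
Proof. by rewrite /ch opprK addrC. Qed.

Lemma shN x : sh (- x) = - sh x.
Proof. by rewrite /sh opprK; field. Qed.

Lemma chD x y : ch (x + y) = ch x * ch y + sh x * sh y.
Proof. by rewrite /ch /sh opprD !expRD; field. Qed.

Lemma shD x y : sh (x + y) = sh x * ch y + ch x * sh y.
Proof. by rewrite /ch /sh opprD !expRD; field. Qed.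

Lemma chB x y : ch (x - y) = ch x * ch y - sh x * sh y.
Proof. by rewrite chD chN shN mulrN. Qed.

Lemma sqr_ch x : ch x ^+ 2 = 1 + sh x ^+ 2.
Proof.
have : ch (x - x) = 1 by rewrite subrr ch0.
by rewrite chB => h; lra.
Qed.

Lemma sh_ge0 x : 0 <= x -> 0 <= sh x.
Proof. by move=> x0; rewrite /sh divr_ge0 // subr_ge0 ler_expR; lra. Qed.

Lemma sh_gt0 x : 0 < x -> 0 < sh x.
Proof. by move=> x0; rewrite /sh divr_gt0 // subr_gt0 ltr_expR; lra. Qed.

Lemma ch_gt0 x : 0 < ch x.
Proof. by rewrite /ch divr_gt0 // addr_gt0 ?expR_gt0. Qed.

Lemma ch_ge1 x : 1 <= ch x.
Proof.
have := sqr_ge0 (sh x); have := sqr_ch x; have := ch_gt0 x; nra.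
Qed.

Lemma chB_prod x y :
  ch y - ch x = 2 * (sh ((y + x) / 2) * sh ((y - x) / 2)).
Proof.
have -> : ch y = ch ((y + x) / 2 + (y - x) / 2) by congr ch; field.
have -> : ch x = ch ((y + x) / 2 - (y - x) / 2) by congr ch; field.
by rewrite chB chD; ring.
Qed.

Lemma ch_le x y : 0 <= x -> x <= y -> ch x <= ch y.
Proof.
move=> x0 xy; rewrite -subr_ge0 chB_prod mulr_ge0 // mulr_ge0 ?sh_ge0 //; lra.
Qed.

Lemma ch_lt x y : 0 <= x -> x < y -> ch x < ch y.
Proof.
move=> x0 xy; rewrite -subr_gt0 chB_prod mulr_gt0 // mulr_gt0 ?sh_gt0 //; lra.
Qed.

Lemma ch_le_inv x y : 0 <= y -> ch x <= ch y -> x <= y.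
Proof. by move=> y0; apply: contraTT; rewrite -!ltNge; exact: ch_lt. Qed.

Lemma ch_abs x : ch `|x| = ch x.
Proof. by case: (ger0P x) => // _; rewrite chN. Qed.

Lemma arcosh_ch d : 0 <= d -> arcosh (ch d) = d.
Proof.
move=> d0; rewrite /arcosh sqr_ch addrAC subrr add0r sqrtr_sqr ger0_norm ?sh_ge0 //.
by rewrite -[RHS]expRK; congr ln; rewrite /ch /sh; field.
Qed.

Lemma ch_arcosh x : 1 <= x -> ch (arcosh x) = x.
Proof.
move=> x1; rewrite /ch /arcosh expRN.
have h : 0 <= x ^+ 2 - 1 by nra.
have s0 := sqrtr_ge0 (x ^+ 2 - 1).
have s2 := sqr_sqrtr h.
rewrite lnK ?posrE; last by lra.
have -> : (x + Num.sqrt (x ^+ 2 - 1))^-1 = x - Num.sqrt (x ^+ 2 - 1).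
  apply: (@mulfI _ (x + Num.sqrt (x ^+ 2 - 1))); first by apply/eqP; lra.
  by rewrite mulfV; [lra | apply/eqP; lra].
by field.
Qed.

(** Geodesic polar coordinates around the apex of the hyperboloid; [(u, v)] is
    a unit direction. *)
Definition polar s u v : R * R := (sh s * u, sh s * v).

Lemma hyp_dist_polar s u v t u' v' :
  u ^+ 2 + v ^+ 2 = 1 -> u' ^+ 2 + v' ^+ 2 = 1 ->
  hyp_dist (polar s u v) (polar t u' v') =
    arcosh (ch s * ch t - sh s * sh t * (u * u' + v * v')).
Proof.
have hh a b c : b ^+ 2 + c ^+ 2 = 1 -> hyp_height (polar a b c) = ch a.
  move=> bc; rewrite /hyp_height /=.
  have -> : 1 + (sh a * b) ^+ 2 + (sh a * c) ^+ 2 = ch a ^+ 2.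
    by rewrite sqr_ch !exprMn -addrA -mulrDr bc mulr1.
  by rewrite sqrtr_sqr gtr0_norm ?ch_gt0.
by move=> h h'; rewrite /hyp_dist !hh //=; congr arcosh; ring.
Qed.

End HyperbolicFunctions.

Section Comparison.
Context {R : realType} {X : metricType R}.
Implicit Types (x y z o : X) (a b : R -> X) (s t la lb u : R).

Lemma geodesic_path_dist a la x y : geodesic_path a la x y -> mdist x y = la.
Proof.
case=> l0 <- <- h; rewrite h ?lexx ?l0 //.
by rewrite sub0r normrN ger0_norm.
Qed.

Lemma geodesic_path_sub a la x y s t : geodesic_path a la x y ->
  0 <= s <= la -> 0 <= t <= la -> mdist (a s) (a t) = `|s - t|.
Proof. by case=> _ _ _; apply. Qed.

Lemma rev_geodesic_path a la x y : geodesic_path a la x y ->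
  geodesic_path (fun s => a (la - s)) la y x.
Proof.
move=> [l0 a0 al h]; split => //; rewrite ?subr0 ?subrr // => s t hs ht.
by rewrite h; [rewrite distrC; congr `|_|; ring | lra | lra].
Qed.

(** Both triangles have the angle whose cosine is [u] at the common vertex:
    the hyperbolic law of cosines determines [u] from the three sides, and then
    bounds the distance of two points on the sides issuing from that vertex. *)
Lemma cat_law_of_cosines o x y a b la lb s t : cat_minus_one X ->
  geodesic_path a la o x -> geodesic_path b lb o y ->
  0 <= s <= la -> 0 <= t <= lb ->
  exists u, [/\ -1 <= u <= 1,
    ch (mdist x y) = ch la * ch lb - sh la * sh lb * u &
    ch (mdist (a s) (b t)) <= ch s * ch t - sh s * sh t * u].
Proof.
move=> [_ cat] pa pb hs ht.
have dx := geodesic_path_dist pa; have dy := geodesic_path_dist pb.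
have la0 : 0 <= la by rewrite -dx mdist_ge0.
have lb0 : 0 <= lb by rewrite -dy mdist_ge0.
set c := mdist x y.
have c0 : 0 <= c by exact: mdist_ge0.
have c1 : c <= la + lb.
  by rewrite -dx -dy (metric_sym o x); exact: metric_triangle.
have c2 : `|la - lb| <= c.
  have h1 := metric_triangle o x y; have h2 := metric_triangle o y x.
  by rewrite dx dy (metric_sym y x) -/c in h1 h2; rewrite ler_norml; lra.
have [u [u1 uc]] : exists u, -1 <= u <= 1 /\ ch c = ch la * ch lb - sh la * sh lb * u.
  have [la00|lap] := eqVneq la 0.
    exists 1; split; first lra; rewrite la00 ch0 sh0 !mul0r subr0 mul1r.
    move: c1 c2; rewrite la00 sub0r normrN ger0_norm // add0r => h1 h2.
    by congr ch; lra.
  have [lb00|lbp] := eqVneq lb 0.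
    exists 1; split; first lra; rewrite lb00 ch0 sh0 mulr0 mul0r subr0 mulr1.
    move: c1 c2; rewrite lb00 subr0 ger0_norm // addr0 => h1 h2.
    by congr ch; lra.
  have sa : 0 < sh la by apply: sh_gt0; rewrite lt0r lap.
  have sb : 0 < sh lb by apply: sh_gt0; rewrite lt0r lbp.
  have sab := mulr_gt0 sa sb.
  exists ((ch la * ch lb - ch c) / (sh la * sh lb)); split; last first.
    by rewrite [sh la * sh lb * _]mulrC divfK ?gt_eqF //; ring.
  have h1 := ch_le c0 c1; have h2 := ch_le (normr_ge0 _) c2.
  rewrite ch_abs chB in h2; rewrite chD in h1.
  by rewrite ler_pdivlMr // ler_pdivrMr //; lra.
exists u; split => //.
have v1 : 0 <= 1 - u ^+ 2 by nra.
set v := Num.sqrt (1 - u ^+ 2).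
have uv : u ^+ 2 + v ^+ 2 = 1 by rewrite sqr_sqrtr //; ring.
have e1 : 1 ^+ 2 + 0 ^+ 2 = 1 :> R by rewrite expr1n expr0n addr0.
have ss0 : 0 <= sh s * sh t by rewrite mulr_ge0 // sh_ge0; lra.
have Q1 : 1 <= ch s * ch t - sh s * sh t * u.
  have := ch_ge1 (s - t); rewrite chB => h.
  have : sh s * sh t * u <= sh s * sh t by rewrite ler_piMr //; lra.
  lra.
have ray (k l w w' : R) : 0 <= k <= l -> w ^+ 2 + w' ^+ 2 = 1 ->
    hyp_dist (polar k w w') (polar l w w') = l - k.
  move=> kl ww; rewrite hyp_dist_polar // -!expr2 ww mulr1 -chB.
  by rewrite -ch_abs arcosh_ch // distrC ger0_norm //; lra.
have apex (k w w' : R) : 0 <= k -> w ^+ 2 + w' ^+ 2 = 1 ->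
    hyp_dist (polar 0 1 0) (polar k w w') = k.
  by move=> k0 ww; rewrite (hyp_dist_polar _ _ e1 ww) sh0 !mul0r subr0 ch0 mul1r arcosh_ch.
have /= := cat o x y a b la lb s t (polar 0 1 0) (polar la 1 0) (polar lb u v)
  (polar s 1 0) (polar t u v) pa pb.
rewrite !apex ?ray ?dx ?dy ?(hyp_dist_polar _ _ e1 uv) //; try lra.
rewrite mul1r mul0r addr0 -uc arcosh_ch // => /(_ erefl erefl erefl hs ht).
move=> /(_ erefl erefl erefl erefl) h.
by rewrite -[leRHS](ch_arcosh Q1) ch_le ?mdist_ge0.
Qed.

End Comparison.

(** * Gromov products and axes *)

Section GromovProduct.
Context {R : realType} {X : metricType R}.
Implicit Types (x y z o p : X) (a b c : R -> X) (s t la lb : R).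

Lemma gromov_productC o x y : gromov_product o x y = gromov_product o y x.
Proof. by rewrite /gromov_product (metric_sym x y); ring. Qed.

Lemma gromov_product_ge0 o x y : 0 <= gromov_product o x y.
Proof.
rewrite /gromov_product divr_ge0 // subr_ge0 (metric_sym y o).
exact: metric_triangle.
Qed.

Lemma gromov_product_lel o x y : gromov_product o x y <= mdist o x.
Proof.
have := metric_triangle y x o; rewrite /gromov_product (metric_sym o x).
by rewrite (metric_sym y x) => h; rewrite ler_pdivrMr //; lra.
Qed.

Lemma gromov_product_ler o x y : gromov_product o x y <= mdist o y.
Proof. by rewrite gromov_productC gromov_product_lel. Qed.

Lemma gromov_product_swap o p x :
  gromov_product p o x = mdist o p - gromov_product o p x.
Proof.
rewrite /gromov_product (metric_sym p o) (metric_sym x o) (metric_sym x p).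
by field.
Qed.

Lemma gromov_product_near o x y z :
  gromov_product o x y <= gromov_product o x z + mdist y z.
Proof.
have h1 := metric_triangle y z o; have h2 := metric_triangle x y z.
by rewrite /gromov_product; lra.
Qed.

Lemma gromov_product_base o p x y :
  gromov_product o x y <= gromov_product p x y + mdist o p.
Proof.
have h1 := metric_triangle x p o; have h2 := metric_triangle y p o.
by rewrite /gromov_product (metric_sym o p); lra.
Qed.

Lemma gromov_product_isom (g : isom X) o x y :
  gromov_product (g o) (g x) (g y) = gromov_product o x y.
Proof. by rewrite /gromov_product !isom_dist. Qed.

Lemma gromov_product_geodesic a la o x t : geodesic_path a la o x ->
  0 <= t <= la -> gromov_product o x (a t) = t.
Proof.
move=> pa ht; have [l0 a0 al h] := pa.
have d1 : mdist x o = la by rewrite metric_sym (geodesic_path_dist pa).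
have d2 : mdist (a t) o = t.
  by rewrite -a0 h ?subr0 ?ger0_norm ?lexx ?l0 //; lra.
have d3 : mdist x (a t) = la - t.
  by rewrite -al h ?ger0_norm ?lexx ?l0 //; lra.
by rewrite /gromov_product d1 d2 d3; field.
Qed.

(** The sides of a hyperbolic triangle issuing from a vertex stay close up to
    the Gromov product of the other two: two points at distance [s] from the
    vertex are at a distance [d] with [cosh d <= 1 + 1/2]. *)
Lemma sides_fellow_travel o x y a b la lb s : cat_minus_one X ->
  geodesic_path a la o x -> geodesic_path b lb o y ->
  0 <= s <= gromov_product o x y -> mdist (a s) (b s) <= 2.
Proof.
move=> cat pa pb /andP[s0 sp].
have dx := geodesic_path_dist pa; have dy := geodesic_path_dist pb.
have pla := gromov_product_lel o x y; have plb := gromov_product_ler o x y.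
have defp : gromov_product o x y = (la + lb - mdist x y) / 2.
  by rewrite /gromov_product (metric_sym x o) (metric_sym y o) dx dy.
move: defp pla plb sp; rewrite dx dy.
set p := gromov_product o x y; set c := mdist x y => defp pla plb sp.
have hs : 0 <= s <= la by rewrite s0 (le_trans sp).
have hs' : 0 <= s <= lb by rewrite s0 (le_trans sp).
have [u [u1 uc ub]] := cat_law_of_cosines cat pa pb hs hs'.
have e2 : 2 <= ch (2 : R).
  have -> : (2 : R) = 1 + 1 by ring.
  rewrite /ch expRD; have := @expR_ge1Dx R 1.
  by have := @expR_gt0 R (- (1 + 1)); nra.
suff h : sh s ^+ 2 * (1 - u) <= 1 / 2.
  apply: ch_le_inv => //; apply: le_trans ub _.
  by rewrite -!expr2 sqr_ch; lra.
have [->|sn0] := eqVneq s 0; first by rewrite sh0 expr0n mul0r; lra.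
have sp0 : 0 < s by rewrite lt0r sn0.
have sa : 0 < sh la by apply: sh_gt0; lra.
have sb : 0 < sh lb by apply: sh_gt0; lra.
have split2 l : p <= l -> 2 * (sh s * sh (l - p)) <= sh l.
  move=> pl; have -> : sh l = sh (p + (l - p)) by congr sh; ring.
  rewrite (shD p (l - p)); have A0 : 0 <= sh (l - p) by apply: sh_ge0; lra.
  have chsh (k : R) : sh k <= ch k.
    by rewrite /sh /ch; have := expR_gt0 (- k); lra.
  have s_p : sh s <= sh p.
    have -> : p = s + (p - s) by ring.
    rewrite shD; have := ch_ge1 (p - s); have := sh_ge0 s0.
    have : 0 <= sh (p - s) by apply: sh_ge0; lra.
    move=> h1 h2 h3; apply: le_trans (_ : sh s * ch (p - s) <= _).
      by rewrite ler_peMr.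
    by rewrite lerDl mulr_ge0 // ltW // ch_gt0.
  have h1 : sh s * sh (l - p) <= sh p * ch (l - p).
    by rewrite ler_pM // ?sh_ge0.
  have h2 : sh s * sh (l - p) <= ch p * sh (l - p).
    by rewrite ler_wpM2r // (le_trans s_p).
  lra.
have e : sh la * sh lb * (1 - u) = 2 * (sh (la - p) * sh (lb - p)).
  have := chB_prod (la - lb) c; rewrite uc chB.
  have -> : (c + (la - lb)) / 2 = la - p by rewrite defp; field.
  have -> : (c - (la - lb)) / 2 = lb - p by rewrite defp; field.
  by move=> h; lra.
have h1 := split2 _ pla; have h2 := split2 _ plb.
have h3 : (2 * (sh s * sh (la - p))) * (2 * (sh s * sh (lb - p))) <=
    sh la * sh lb.
  by rewrite ler_pM // mulr_ge0 // mulr_ge0 // sh_ge0 //; lra.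
have sab := mulr_gt0 sa sb.
rewrite -(ler_pM2r sab).
have -> : sh s ^+ 2 * (1 - u) * (sh la * sh lb) =
  sh s ^+ 2 * (sh la * sh lb * (1 - u)) by ring.
by rewrite e; nra.
Qed.

(** Gromov hyperbolicity, the only consequence of negative curvature used
    outside of the construction of axes. *)
Lemma four_point o x y z : cat_minus_one X ->
  Num.min (gromov_product o x y) (gromov_product o y z) - 2 <=
    gromov_product o x z.
Proof.
move=> cat; have [geo _] := cat.
have [a [la pa]] := geo o x; have [b [lb pb]] := geo o y.
have [c [lc pc]] := geo o z.
set s := Num.min _ _.
have s0 : 0 <= s by rewrite le_min !gromov_product_ge0.
have [s1 s2] : s <= gromov_product o x y /\ s <= gromov_product o y z.
  by rewrite !ge_min !lexx orbT.
have h1 : mdist (a s) (b s) <= 2.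
  by apply: (sides_fellow_travel cat pa pb); rewrite s0.
have h2 : mdist (b s) (c s) <= 2.
  by apply: (sides_fellow_travel cat pb pc); rewrite s0.
have dx := geodesic_path_dist pa; have dz := geodesic_path_dist pc.
have sa : 0 <= s <= la.
  by rewrite s0 -dx (le_trans s1) // gromov_product_lel.
have sc : 0 <= s <= lc.
  by rewrite s0 -dz (le_trans s2) // gromov_product_ler.
have e1 : mdist x (a s) = la - s.
  have [l0 _ <- h] := pa; rewrite h ?ger0_norm //; first by lra.
  by rewrite lexx l0.
have e2 : mdist (c s) z = lc - s.
  have [l0 _ <- h] := pc; rewrite h ?ler0_norm //; [by lra| by lra|].
  by rewrite lexx l0.
have h3 := metric_triangle (a s) (b s) (c s).
have h4 := metric_triangle x (a s) z.
have h5 := metric_triangle (a s) (c s) z.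
by rewrite /gromov_product (metric_sym x o) (metric_sym z o) dx dz; lra.
Qed.

Lemma four_point_le o x y z k : cat_minus_one X ->
  gromov_product o x z <= k -> k + 2 < gromov_product o y z ->
  gromov_product o x y <= k + 2.
Proof.
move=> cat h1 h2; have := four_point o x y z cat.
by rewrite minEle; case: ifP => _; lra.
Qed.

Lemma four_point_ge o x y z k : cat_minus_one X ->
  k <= gromov_product o x y -> k <= gromov_product o y z ->
  k - 2 <= gromov_product o x z.
Proof.
move=> cat h1 h2; apply: le_trans (four_point o x y z cat).
by rewrite lerD2r le_min h1.
Qed.

End GromovProduct.

Section Axes.
Context {R : realType} {X : metricType R}.
Implicit Types (g : isom X) (x y z w o : X) (s t tau : R).

(** The angle at [g w] between the geodesics to [w] and to [g (g w)] is
    controlled by the displacement of the midpoint of [w] and [g w]. *)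
Lemma double_displacement g tau : cat_minus_one X -> 0 <= tau ->
  (forall w, tau <= mdist w (g w)) ->
  forall w, 2 * tau <= mdist w (g (g w)).
Proof.
move=> cat t0 disp w; have [geo _] := cat.
have [b [l pb]] := geo w (g w).
have dl := geodesic_path_dist pb; have tl := disp w; rewrite dl in tl.
have pa := rev_geodesic_path pb.
have pg : geodesic_path (g \o b) l (g w) (g (g w)).
  have [l0 b0 bl h] := pb; split => //=; rewrite ?b0 ?bl //.
  by move=> s t hs ht; rewrite isom_dist h.
have hl : 0 <= l / 2 <= l by lra.
have [u [u1 uc ub]] := cat_law_of_cosines cat pa pg hl hl.
have em : l - l / 2 = l / 2 by field.
move: ub; rewrite /= em => ub.
have := le_trans (ch_le t0 (disp _)) ub => {}ub.
apply: ch_le_inv; first exact: mdist_ge0.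
rewrite uc; have -> : 2 * tau = tau + tau by ring.
have ell : l = l / 2 + l / 2 by field.
have tl' := ch_le t0 tl; rewrite {1}ell chD in tl'.
rewrite {1 2 3 4}ell !chD !shD.
have := sqr_ch tau; have := sqr_ch (l / 2); have := ch_ge1 tau.
move: tl' ub; set A := ch (l / 2); set B := sh (l / 2); set T := ch tau.
rewrite -!expr2 => tl' ub T1 AB TB.
have q0 := sqr_ge0 B.
have -> : T ^+ 2 + sh tau ^+ 2 = 1 + 2 * ((T - 1) * (T + 1)) by rewrite expr2 in TB *; nra.
have -> : (A ^+ 2 + B ^+ 2) * (A ^+ 2 + B ^+ 2) -
    (B * A + A * B) * (B * A + A * B) * u =
    1 + 4 * (A ^+ 2 * (B ^+ 2 * (1 - u))).
  have -> : (B * A + A * B) * (B * A + A * B) = 4 * (A ^+ 2 * B ^+ 2) by ring.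
  by rewrite AB; ring.
have h : T - 1 <= B ^+ 2 * (1 - u) by rewrite AB in ub; lra.
have h' : T + 1 <= 2 * A ^+ 2 by lra.
have T0 : 0 <= T - 1 by lra.
have A0 := sqr_ge0 A.
have := ler_pM T0 (_ : 0 <= T + 1) h h'; rewrite (_ : 0 <= T + 1); last by lra.
by move=> /(_ isT); lra.
Qed.

Lemma iter_displacement g tau k : cat_minus_one X -> 0 <= tau ->
  (forall w, tau <= mdist w (g w)) ->
  forall w, (2 ^ k)%:R * tau <= mdist w ((g ^+ (2 ^ k))%g w).
Proof.
move=> cat t0 disp; elim: k => [|k ih] w.
  by rewrite expn0 expg1 mul1r.
have h := double_displacement cat (mulr_ge0 (ler0n _ _) t0) ih w.
rewrite expnS mul2n -addnn expgnDr natrD; apply: le_trans h; lra.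
Qed.

(** The displacement of [g ^+ n] is at most [n tau] on the orbit of [z], and at
    least that for [n] a power of two, hence for every [n]. *)
Lemma orbit_geodesic g tau z n : cat_minus_one X -> 0 <= tau ->
  (forall w, tau <= mdist w (g w)) -> mdist z (g z) = tau ->
  mdist z ((g ^+ n)%g z) = n%:R * tau.
Proof.
move=> cat t0 disp ez.
have up m w : mdist w (g w) = tau -> mdist w ((g ^+ m)%g w) <= m%:R * tau.
  elim: m w => [|m ih] w ew; first by rewrite mul0r expg0 /= mdistxx.
  rewrite expgS /=; apply: le_trans (metric_triangle _ (g w) _) _.
  rewrite ew isom_dist -[m.+1]addn1 natrD mulrDl mul1r addrC lerD2r.
  exact: ih.
apply/eqP; rewrite eq_le up //=.
have nn : (n <= 2 ^ n)%N by rewrite ltnW // ltn_expl.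
have := iter_displacement n cat t0 disp z.
rewrite -{2}(subnKC nn) expgnDr /= => h.
have := metric_triangle z ((g ^+ n)%g z) ((g ^+ n)%g ((g ^+ (2 ^ n - n))%g z)).
rewrite isom_dist => h1; have := up (2 ^ n - n)%N z ez.
by rewrite natrB // mulrBl; lra.
Qed.

(** Integral powers, which are needed to travel along an axis in both
    directions. *)
Definition isom_zpow g (k : int) : isom X :=
  match k with Posz n => (g ^+ n)%g | Negz n => (g ^- n.+1)%g end.

Lemma isom_zpow1D g k : isom_zpow g (k + 1) = (g * isom_zpow g k)%g.
Proof.
case: k => [n|[|n]].
- by rewrite -PoszD addn1 /= expgS.
- by rewrite NegzE addNr /= mulgV.
- have -> : Negz n.+1 + 1 = Negz n.
    by rewrite !NegzE -(addn1 n.+1) PoszD opprD subrK.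
  by rewrite /= [in RHS]expgSr invgM mulgA mulgV mul1g.
Qed.

Lemma isom_zpowDn g k n : isom_zpow g (k + n%:Z) = (g ^+ n * isom_zpow g k)%g.
Proof.
elim: n => [|n ih]; first by rewrite addr0 mul1g.
by rewrite -addn1 PoszD addrA isom_zpow1D ih addn1 expgS mulgA.
Qed.

Lemma isom_zpow_comm g k : commute g (isom_zpow g k).
Proof.
case: k => n /=; first by apply: commuteX; exact: commute_refl.
by apply: commuteV; apply: commuteX; exact: commute_refl.
Qed.

(** Join the consecutive points of the orbit of a point [z] of minimal
    displacement by translates of one geodesic [b].  The resulting curve has
    speed at most one, and it cannot be any shorter because the orbit of [z]
    itself is geodesic. *)
Lemma hyperbolic_axis g : cat_minus_one X -> hyperbolic g ->
  exists z, axis g z.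
Proof.
move=> cat [t0 [z ez]]; set tau := translation_length g in t0 ez *.
have disp w : tau <= mdist w (g w).
  apply: ge_inf; last by exists w.
  by exists 0 => _ [y _ <-]; exact: mdist_ge0.
have [geo _] := cat; have [b [l pb]] := geo z (g z).
have lt := geodesic_path_dist pb; rewrite ez in lt; subst l.
have [_ b0 bt hb] := pb.
pose fl s := Num.floor (s / tau).
pose rem s := s - (fl s)%:~R * tau.
pose c s := isom_zpow g (fl s) (b (rem s)).
have rem_itv s : 0 <= rem s < tau.
  have /andP[h1 h2] := floor_itv (s / tau).
  rewrite ler_pdivlMr // in h1; rewrite ltr_pdivrMr // intrD mulrDl mul1r in h2.
  by rewrite /rem /fl; lra.
have cE s : s = (fl s)%:~R * tau + rem s by rewrite /rem; ring.
have orb i n : mdist (isom_zpow g i z) (isom_zpow g (i + n%:Z) z) = n%:R * tau.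
  have cm : commute (g ^+ n)%g (isom_zpow g i).
    exact/commute_sym/commuteX/commute_sym/isom_zpow_comm.
  by rewrite isom_zpowDn cm /= isom_dist (orbit_geodesic n cat (ltW t0) disp ez).
have line_le s t : s <= t -> mdist (c s) (c t) = t - s.
  move=> st; have ij : fl s <= fl t.
    by apply: le_floor; rewrite ler_pM2r // invr_gt0.
  have [n en] : exists n : nat, fl t = fl s + n%:Z.
    exists `|fl t - fl s|%N; rewrite gez0_abs ?subr_ge0 //; ring.
  have es := cE s; have et := cE t; have rs := rem_itv s; have rt := rem_itv t.
  have e1 k r : 0 <= r <= tau ->
      mdist (isom_zpow g k z) (isom_zpow g k (b r)) = r.
    by move=> hr; rewrite isom_dist -b0 hb ?sub0r ?normrN ?ger0_norm //; lra.
  have e2 k r : 0 <= r <= tau ->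
      mdist (isom_zpow g k (b r)) (isom_zpow g (k + 1) z) = tau - r.
    move=> hr; rewrite isom_zpow1D isom_zpow_comm /= isom_dist -bt.
    by rewrite hb ?ler0_norm; lra.
  have lo : (n.+1)%:R * tau <= rem s + mdist (c s) (c t) + (tau - rem t).
    rewrite -(orb (fl s)) -[n.+1]addn1 PoszD addrA -en.
    apply: le_trans (metric_triangle _ (c t) _) _.
    rewrite e2; last by lra.
    rewrite lerD2r; apply: le_trans (metric_triangle _ (c s) _) _.
    by rewrite e1 //; lra.
  have ent : (fl t)%:~R = (fl s)%:~R + n%:R :> R.
    by rewrite en intrD.
  apply/eqP; rewrite eq_le; apply/andP; split; last first.
    by rewrite -addn1 natrD in lo; rewrite ent in et; lra.
  case: n => [|n] in en ent lo *.
    have efl : fl t = fl s by rewrite en addr0.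
    by rewrite efl in et; rewrite /c efl isom_dist hb ?ler0_norm; lra.
  apply: le_trans (metric_triangle _ (isom_zpow g (fl s + 1) z) _) _.
  rewrite e2; last by lra.
  apply: (@le_trans _ _ (tau - rem s + (n%:R * tau + rem t))).
    rewrite lerD2l -(orb (fl s + 1)).
    have -> : fl s + 1 + n = fl t by rewrite en -[n.+1]add1n PoszD addrA.
    apply: le_trans (metric_triangle _ (isom_zpow g (fl t) z) _) _.
    by rewrite e1 //; lra.
  by rewrite -addn1 natrD in ent; rewrite ent in et; lra.
have line : geodesic_line c.
  move=> s t; have [st|ts] := leP s t.
    by rewrite line_le // ler0_norm ?opprB // subr_le0.
  by rewrite metric_sym (line_le _ _ (ltW ts)) gtr0_norm // subr_gt0.
exists (c 0), c; split => //; last by exists 0.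
move=> s; rewrite -/tau.
have fl1 : fl (s + tau) = fl s + 1.
  by rewrite /fl mulrDl mulfV ?gt_eqF // floorDrz // floor1.
have r1 : rem (s + tau) = rem s by rewrite /rem fl1 intrD; ring.
by rewrite /c r1 fl1 isom_zpow1D.
Qed.

(** Compare the displacement of [o] with that of a nearby point of the axis. *)
Lemma displacement_le_axis_length g o : cat_minus_one X -> hyperbolic g ->
  mdist o (g o) <= axis_length o g.
Proof.
move=> cat hg; have [z0 az0] := hyperbolic_axis cat hg.
have hinf : has_inf [set mdist o z | z in axis g].
  split; first by exists (mdist o z0), z0.
  by exists 0 => _ [y _ <-]; exact: mdist_ge0.
apply/ler_addgt0Pr => e e0; rewrite /axis_length.
have e20 : 0 < e / 2 by lra.
have [_ [z [c [lc gc [t zt]]] <-] hz] := inf_adherent e20 hinf.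
have h1 := metric_triangle o z (g o).
have h2 := metric_triangle z (g z) (g o).
have h3 : mdist z (g z) = translation_length g.
  rewrite zt gc lc opprD addrA subrr sub0r normrN ger0_norm //.
  by case: hg => /ltW.
have h4 : mdist (g z) (g o) = mdist o z by rewrite isom_dist metric_sym.
by rewrite h3 h4 in h2; lra.
Qed.

End Axes.

(** * Discrete groups of isometries *)

(** Apply the covering form of compactness to the filter of the finite lists
    containing a given finite list. *)
Lemma compact_finite_net (R : realType) (X : metricType R) (K : set X) (e : R) :
  0 < e -> compact K ->
  exists Q : seq X, forall x, K x -> exists2 q, q \in Q & mdist q x < e.
Proof.
move=> e0 /compact_near_coveringP cK.
pose F : set_system (seq X) :=
  [set S : set (seq X) | exists l0 : seq X,
     forall l : seq X, {subset l0 <= l} -> S l].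
have FF : Filter F.
  split; first by exists [::].
  - move=> S S' [l hl] [l' hl']; exists (l ++ l') => k hk; split.
      by apply: hl => x xl; apply: hk; rewrite mem_cat xl.
    by apply: hl' => x xl; apply: hk; rewrite mem_cat xl orbT.
  - by move=> S S' SS' [l hl]; exists l => k hk; exact/SS'/hl.
have [] := cK _ F (fun (l : seq X) x => exists2 q, q \in l & mdist q x < e) FF.
  move=> x Kx; exists (ball x e, [set l : seq X | x \in l]) => /=.
    split; first exact: nbhsx_ballx.
    by exists [:: x] => l hl; apply: hl; rewrite mem_head.
  by case=> y l /= [+ xl]; rewrite ballEmdist /= => xy; exists x.
by move=> l hl; exists l; exact: hl.
Qed.

Lemma infinite_pigeonhole (T : eqType) (F : seq T) (f : nat -> T) (I : set nat) :
  (forall N, exists2 n, (N <= n)%N & I n) -> (forall n, I n -> f n \in F) ->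
  exists v, forall N, exists2 n, (N <= n)%N & I n /\ f n = v.
Proof.
elim: F I => [|v F ih] I infI hF.
  by have [n _ /hF] := infI 0%N; rewrite in_nil.
have [h|] := pselect (forall N, exists2 n, (N <= n)%N & I n /\ f n = v).
  by exists v.
move=> /existsNP[N hN].
have hI n : (N <= n)%N -> I n -> f n <> v.
  by move=> Nn In fv; apply: hN; exists n.
have [||w hw] := ih (I `&` [set n | (N <= n)%N]).
- move=> M; have [n Mn In] := infI (maxn M N).
  by exists n; [exact: leq_trans (leq_maxl _ _) Mn | split => //=;
    exact: leq_trans (leq_maxr _ _) Mn].
- move=> n [In Nn]; have := hF n In; rewrite inE => /orP[/eqP fv|//].
  by have := hI n Nn In.
- by exists w => M; have [n Mn [[In _] fw]] := hw M; exists n.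
Qed.

Lemma sum_le_size_max (U : eqType) (m : U -> nat) (p : U) (Q : seq U) :
  exists2 q, q \in p :: Q &
    (\sum_(r <- p :: Q) m r <= size (p :: Q) * m q)%N.
Proof.
elim: Q p => [|p' Q ih] p.
  by exists p; rewrite ?mem_head // big_seq1 mul1n.
have [q qQ hq] := ih p'.
have [pq|qp] := leqP (m p) (m q).
  by exists q; [rewrite inE qQ orbT | rewrite big_cons leq_add].
exists p; first exact: mem_head.
rewrite big_cons leq_add2l (leq_trans hq) //.
by rewrite leq_mul2l (ltnW qp) orbT.
Qed.

Lemma finite_pigeonhole (T U : eqType) (Q : seq U) (P : T -> U -> bool)
    (A : seq T) : (forall g, g \in A -> exists2 q, q \in Q & P g q) ->
  A = [::] \/
  exists2 q, q \in Q & (size A <= size Q * size [seq g <- A | P g q])%N.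
Proof.
move=> hA.
have hsum : (size A <= \sum_(q <- Q) size [seq g <- A | P g q])%N.
  elim: A hA => [|g A ih] hA //=.
  have [q qQ Pq] := hA g (mem_head _ _).
  have {}ih := ih (fun h hh => hA h (mem_behead (s := g :: A) hh)).
  rewrite (big_rem q) //= Pq /= addSn ltnS; apply: leq_trans ih _.
  rewrite [leqLHS](big_rem q) //= leq_add2l; apply: leq_sum => p _.
  by case: (P g p) => /=.
case: A hA hsum => [|g A] hA hsum; [by left | right].
have [] := hA g (mem_head _ _); case: Q {hA} hsum => [|p Q] hsum // _ _ _.
have [q qQ hq] := sum_le_size_max (fun q => size [seq h <- g :: A | P h q]) p Q.
by exists q => //; exact: leq_trans hsum hq.
Qed.

(** Greedy choice: each chosen element excludes at most [M] elements. *)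
Lemma sparse_sublist (T : eqType) (r : rel T) (M : nat) (A : seq T) :
  symmetric r -> uniq A -> (forall x, x \in A -> r x x) ->
  (forall x, x \in A -> (count (r x) A <= M)%N) ->
  exists F : seq T, [/\ uniq F, {subset F <= A},
    {in F &, forall x y, x != y -> ~~ r x y} & (size A <= M * size F)%N].
Proof.
move=> sr; have [n] := ubnP (size A); elim: n A => // n ih [|x A] /=.
  by move=> *; exists [::].
rewrite ltnS => sz /andP[xA uA] rA hA.
pose A' := [seq y <- A | ~~ r x y].
have sub : {subset A' <= A} by move=> y; rewrite mem_filter => /andP[].
have rx : r x x by apply: rA; rewrite mem_head.
have [||||F [uF FA Fr Fs]] := ih A'.
- by rewrite (leq_ltn_trans _ sz) // size_filter count_size.
- by rewrite filter_uniq.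
- by move=> y /sub yA; rewrite rA // inE yA orbT.
- move=> y /sub yA; have := hA y; rewrite inE yA orbT => /(_ isT).
  apply: leq_trans; rewrite /A' count_filter (leq_trans _ (leq_addl _ _)) //.
  by apply: sub_count => z /= /andP[].
exists (x :: F); split.
- rewrite /= uF andbT; apply/negP => /FA; rewrite mem_filter => /andP[_].
  by apply/negP.
- by move=> y; rewrite !inE => /orP[->//|/FA/sub ->]; rewrite orbT.
- have xF y : y \in F -> ~~ r x y by move=> /FA; rewrite mem_filter => /andP[].
  move=> y z; rewrite !inE => /orP[/eqP->|yF] /orP[/eqP->|zF] //.
  + by rewrite eqxx.
  + by move=> _; exact: xF.
  + by move=> _; rewrite sr; exact: xF.
  + exact: Fr.
- rewrite /= mulnS; have := hA x (mem_head _ _); rewrite /= rx add1n => hM.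
  rewrite -(count_predC (r x) A) -addSn leq_add //.
  by apply: leq_trans Fs; rewrite size_filter.
Qed.

Section IsomAction.
Context {R : realType} {X : metricType R}.
Implicit Types (g h : isom X) (x : X).

Lemma isom_mulE g h x : (g * h)%g x = g (h x).
Proof. by []. Qed.

Lemma isom_invK g x : (g^-1)%g (g x) = x.
Proof. exact: isomK. Qed.

Lemma isom_invVK g x : g ((g^-1)%g x) = x.
Proof. exact: isomVK. Qed.

End IsomAction.

Section OrbitGrowth.
Context {R : realType} {X : metricType R}.
Variables (Gam : set (isom X)) (o : X).
Implicit Types (g h : isom X) (x y : X) (s t r K C : R).

Local Notation "`[ g ]" := (mdist o (g o)) (at level 0, format "`[ g ]").

Definition finite_balls : Prop :=
  forall r, exists l : seq (isom X), uniq l /\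
    forall g, g \in l <-> Gam g /\ `[g] <= r.

Definition poincare s : \bar R := \esum_(g in Gam) (expR (- (s * `[g])))%:E.

Lemma poincare_sum_le s (l : seq (isom X)) : uniq l ->
  (forall g, g \in l -> Gam g) ->
  ((\sum_(g <- l) expR (- (s * `[g])))%:E <= poincare s)%E.
Proof.
move=> ul lG; rewrite /poincare /esum; apply: ereal_sup_ubound.
exists [set` l]; first by split => //; apply/finite_seqP; exists l.
by rewrite -fsbig_seq // sumEFin.
Qed.

Lemma poincare_le s t : s <= t -> (poincare t <= poincare s)%E.
Proof.
move=> st; apply: le_esum => g _; rewrite lee_fin ler_expR lerN2.
by rewrite ler_wpM2r ?mdist_ge0.
Qed.

(** Each element of a ball contributes at least [expR (- (s * r))]. *)
Lemma poincare_finite_balls s : 0 <= s -> (poincare s < +oo)%E -> finite_balls.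
Proof.
move=> s0 ps r; pose Br := [set g | Gam g /\ `[g] <= r].
have fB : finite_set Br.
  apply: contrapT => infB.
  have p0 : (0 <= poincare s)%E.
    by apply: esum_ge0 => g _; rewrite lee_fin expR_ge0.
  have pf : poincare s \is a fin_num by rewrite ge0_fin_numE.
  have e0 := expR_gt0 (- (s * r)).
  pose n := (Num.truncn (fine (poincare s) / expR (- (s * r)))).+1.
  have [B BB sB] := infinite_set_fset n infB.
  have BG g : g \in (B : seq _) -> Gam g by move=> gB; have [] := BB g gB.
  have := poincare_sum_le s (fset_uniq B) BG.
  rewrite -(fineK pf) lee_fin; apply/negP; rewrite -ltNge.
  apply: lt_le_trans (_ : n%:R * expR (- (s * r)) <= _).
    by rewrite -ltr_pdivrMr // /n truncnS_gt.
  apply: le_trans (_ : #|` B|%:R * expR (- (s * r)) <= _).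
    by rewrite ler_pM2r // ler_nat.
  have -> : #|` B|%:R * expR (- (s * r)) = \sum_(g <- B) expR (- (s * r)).
    by rewrite big_const_seq iter_addr_0 count_predT mulr_natl.
  rewrite big_seq [leRHS]big_seq.
  apply: ler_sum => g gB; rewrite ler_expR lerN2 ler_wpM2l //.
  by have [] := BB g gB.
have [l lE] := (finite_seqP _).1 fB; exists (undup l); split.
  exact: undup_uniq.
move=> g; rewrite mem_undup; have := congr1 (fun A : set _ => A g) lE.
by rewrite /Br /= => ->.
Qed.

Lemma disp_inv g : `[(g^-1)%g] = `[g].
Proof. by rewrite -(isom_dist g o) isom_invVK metric_sym. Qed.

(** The first step [g] of a path [o], [g o], [g x] is followed by the geodesic
    from [o] to [g x] except for the part which cancels at [g o]. *)
Lemma gromov_product_step g x :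
  gromov_product o (g o) (g x) = `[g] - gromov_product o ((g^-1)%g o) x.
Proof.
rewrite -(gromov_product_isom g o ((g^-1)%g o)) isom_invVK (gromov_product_swap o (g o)).
by ring.
Qed.

Hypotheses (cat : cat_minus_one X) (subG : is_subgroup Gam).
Hypothesis fin : finite_balls.

Let gp := gromov_product o.

(** A quantitative version of: [x] is so close to a point of the boundary fixed
    by the group that the elements of displacement at most [k] do not move it
    visibly. *)
Definition almost_fixed (k : R) x : Prop :=
  forall m, Gam m -> `[m] <= k -> k - 2 <= gp (m x) x.

(** A translate by [g^-1] turns the product of [g o] and [x] at [o] into that of
    [o] and [g^-1 x] at [g^-1 o], and [g^-1 x] cannot be distinguished from [x]
    at the scale of the displacement of [g]. *)
Lemma almost_fixed_inv (k : R) x g K : almost_fixed k x -> Gam g ->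
  gp (g o) x <= K -> `[g] + 2 <= k -> `[g] - K - 2 <= gp ((g^-1)%g o) x.
Proof.
have [_ _ GV] := subG.
move=> fx Gg gK gk; have := fx _ (GV _ Gg); rewrite disp_inv => /(_ _) h.
have {}h : k - 2 <= gp ((g^-1)%g x) x by apply: h; lra.
have K0 : 0 <= K := le_trans (gromov_product_ge0 _ _ _) gK.
apply: four_point_ge cat _ (_ : _ <= gp ((g^-1)%g x) x); last by lra.
by rewrite gromov_product_step disp_inv invgK lerD2l lerN2.
Qed.

(** [g^-1] moves [o] along the geodesic towards [x], and the points of this
    geodesic are all displaced by [h] about as much as [o]. *)
Lemma almost_fixed_conj (k : R) x g h K : almost_fixed k x -> Gam g -> Gam h ->
  gp (g o) x <= K -> `[g] + 2 <= k -> `[h] <= k ->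
  `[(g * h * g^-1)%g] <= 3 * `[h] + (2 * K + 12).
Proof.
move=> fx Gg Gh gK gk hk; have := almost_fixed_inv fx Gg gK gk.
set p := (g^-1)%g o => pK.
have K0 : 0 <= K := le_trans (gromov_product_ge0 _ _ _) gK.
have hx := fx _ Gh hk; have h0 := mdist_ge0 o (h o).
have dp : mdist o p = `[g] by rewrite /p disp_inv.
have h1 := gromov_product_base (h o) o (h p) (h x).
rewrite gromov_product_isom (metric_sym (h o)) in h1.
have h2 : `[g] - K - 2 - `[h] - 2 <= gp (h p) x.
  by apply: four_point_ge cat (_ : _ <= gp (h p) (h x)) _; rewrite /gp in pK hx *; lra.
have h3 : `[g] - K - 2 - `[h] - 2 - 2 <= gp (h p) p.
  by apply: four_point_ge cat h2 _; rewrite gromov_productC; rewrite /gp in pK *; lra.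
have -> : `[(g * h * g^-1)%g] = mdist p (h p).
  by rewrite -(isom_dist (g^-1)%g o) !isom_mulE isom_invK.
have h4 := metric_triangle o (h o) (h p); rewrite isom_dist dp in h4.
move: h3; rewrite /gp /gromov_product !(metric_sym _ o) dp (metric_sym _ p).
by move=> h3; lra.
Qed.

(** The conjugates of a generator by the [a n] lie in a finite ball, so that
    infinitely many [a n] conjugate a finite generating set in the same way;
    the quotients of these centralize the group. *)
Lemma central_subsequence (a : nat -> isom X) C : finitely_generated Gam ->
  (forall n, Gam (a n)) ->
  (forall n h, Gam h -> `[(a n * h * (a n)^-1)%g] <= 3 * `[h] + C) ->
  exists2 g, Gam g & forall N, exists2 n, (N <= n)%N &
    forall h, Gam h -> commute (a n * g^-1)%g h.
Proof.
move=> [S fS GS] Ga aC; have [G1 GM GV] := subG.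
have [l lE] := (finite_seqP _).1 fS.
have lG h : h \in l -> Gam h.
  move=> hl; rewrite GS => K _; apply; rewrite lE; exact: hl.
have [J [infJ Jc]] : exists J : set nat,
    (forall N, exists2 n, (N <= n)%N & J n) /\
    forall h, h \in l -> forall i j, J i -> J j ->
      (a i * h * (a i)^-1 = a j * h * (a j)^-1)%g.
  elim: l {lE} lG => [|h l ih] lG.
    by exists setT; split => // N; exists N.
  have [J [infJ Jc]] := ih (fun g gl => lG g (mem_behead (s := h :: l) gl)).
  have Gh := lG h (mem_head _ _).
  have [F [_ FE]] := fin (3 * `[h] + C).
  have [|v hv] := infinite_pigeonhole (F := F)
    (f := fun n => (a n * h * (a n)^-1)%g) infJ.
    by move=> n _; apply/FE; split; [apply: (GM); [exact: GM | exact: GV] | exact: aC].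
  exists (J `&` [set n | (a n * h * (a n)^-1)%g = v]); split; first exact: hv.
  move=> g; rewrite inE => /orP[/eqP->|gl] i j [Ji ei] [Jj ej].
    by rewrite ei ej.
  exact: Jc.
have [n0 _ Jn0] := infJ 0%N.
exists (a n0) => // N; have [n Nn Jn] := infJ N; exists n => //.
pose z := ((a n0)^-1 * a n)%g.
have zc h : Gam h -> commute z h.
  rewrite GS => /(_ [set h | commute z h]); apply.
    split; first exact: commute1.
      by move=> g h' cg ch; exact: commuteM.
    by move=> g cg; exact: commuteV.
  rewrite lE => g gl /=; have e := Jc g gl n0 n Jn0 Jn.
  have {}e := congr1 (fun u => ((a n0)^-1 * u * a n)%g) e.
  by move: e; rewrite /z /commute !mulgA mulVg mul1g -!mulgA mulVg mulg1 => ->.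
have -> : (a n * (a n0)^-1 = z)%g.
  apply: (@mulIg _ (a n0)); rewrite -mulgA mulVg mulg1 (zc _ (Ga n0)).
  by rewrite /z mulgA mulgV mul1g.
exact: zc.
Qed.

(** For each [k], at most one of the three sequences comes close to the
    direction of [x k], by the four point inequality; some pair of sequences is
    left over infinitely often. *)
Lemma two_directions_avoid (a : 'I_3 -> nat -> isom X) K (x : nat -> X) :
  (forall i j n m, i != j -> gp (a i n o) (a j m o) <= K) ->
  exists i j, i != j /\ forall N, exists2 k, (N <= k)%N &
    forall n, gp (a i n o) (x k) <= K + 2 /\ gp (a j n o) (x k) <= K + 2.
Proof.
move=> aK; apply: contrapT => hno.
pose good i k := forall n, gp (a i n o) (x k) <= K + 2.
have bad i j : i != j ->
    exists N, forall k, (N <= k)%N -> ~ (good i k /\ good j k).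
  move=> ij; apply: contrapT => hN; apply: hno; exists i, j; split => // N.
  apply: contrapT => hk; apply: hN; exists N => k Nk [gi gj].
  by apply: hk; exists k.
pose i0 : 'I_3 := @Ordinal 3 0 isT; pose i1 : 'I_3 := @Ordinal 3 1 isT.
pose i2 : 'I_3 := @Ordinal 3 2 isT.
have [N01 h01] := bad i0 i1 isT; have [N02 h02] := bad i0 i2 isT.
have [N12 h12] := bad i1 i2 isT.
pose k := maxn N01 (maxn N02 N12).
have k1 : (N01 <= k)%N by rewrite leq_maxl.
have k2 : (N02 <= k)%N by rewrite /k maxnCA leq_maxl.
have k3 : (N12 <= k)%N by rewrite /k maxnA leq_maxr.
have one i j : i != j -> ~ good i k -> ~ good j k -> False.
  move=> ij /existsNP[n /negP]; rewrite -ltNge => hn.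
  move=> /existsNP[m /negP]; rewrite -ltNge => hm.
  have := four_point_le cat (aK i j n m ij) (y := x k).
  by rewrite gromov_productC => /(_ hm); rewrite leNgt hn.
case: (pselect (good i0 k)) => g0; case: (pselect (good i1 k)) => g1;
  case: (pselect (good i2 k)) => g2; try by [exact: (h01 k k1) |
    exact: (h02 k k2) | exact: (h12 k k3) | exact: (one i0 i1) |
    exact: (one i0 i2) | exact: (one i1 i2)].
Qed.

(** No boundary point is fixed by the whole group, uniformly: some element of
    bounded displacement moves any direction [x] away from any direction [y].
    Otherwise there are points [x] almost fixed by larger and larger parts of
    the group.  Two sequences of orbit points leave in other directions, and
    conjugation by their members distorts displacements by a bounded amount
    only; since the group is finitely generated, this yields central elements
    [z] and [w] with [z o] and [w o] far away in different directions, while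
    their inverses move [o] towards [x].  Then [z w = w z] moves [o] both in
    the direction of [z o] and in that of [w o]. *)
Lemma visible_motion (a : 'I_3 -> nat -> isom X) K : finitely_generated Gam ->
  (forall i n, Gam (a i n)) -> (forall i n, n%:R <= `[a i n]) ->
  (forall i j n m, i != j -> gp (a i n o) (a j m o) <= K) ->
  exists2 C, 0 <= C & forall x y, exists m,
    [/\ Gam m, `[m] <= C & gp (m x) y <= C].
Proof.
move=> fgG Ga a_big aK; have [G1 GM GV] := subG.
apply: contrapT => hno.
have [x hx] : exists x : nat -> X, forall k : nat, almost_fixed k%:R (x k).
  suff : forall k : nat, exists x, almost_fixed k%:R x.
    by move=> /choice[x hx]; exists x.
  move=> k; apply: contrapT => hk; apply: hno; exists k%:R => // x y.
  apply: contrapT => hm; apply: hk; exists x => m Gm mk.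
  have h m' : Gam m' -> `[m'] <= k%:R -> k%:R <= gp (m' x) y.
    move=> Gm' m'k; rewrite leNgt; apply/negP => hlt; apply: hm.
    by exists m'; split => //; exact: ltW.
  apply: four_point_ge cat (h _ Gm mk) _.
  by rewrite gromov_productC; apply: (h 1%g) => //=; rewrite mdistxx.
have [i [j [ij away]]] := two_directions_avoid x aK.
have dir_conj i' : (forall N, exists2 k, (N <= k)%N &
      forall n, gp (a i' n o) (x k) <= K + 2) ->
    exists2 g, Gam g & forall N, exists2 n, (N <= n)%N &
      forall h, Gam h -> commute (a i' n * g^-1)%g h.
  move=> aw; apply: (@central_subsequence _ (2 * (K + 2) + 12)) => // n h Gh.
  have [k Nk hk] := aw (Num.truncn (`[a i' n] + 2 + `[h])).+1.
  have kR : `[a i' n] + 2 + `[h] <= k%:R.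
    by apply: le_trans (ltW (truncnS_gt _)) _; rewrite ler_nat.
  have := mdist_ge0 o (h o); have := mdist_ge0 o (a i' n o).
  by move=> ? ?; apply: (almost_fixed_conj (hx k)) => //; lra.
have [N|g Gg hg] := dir_conj i.
  by have [k Nk hk] := away N; exists k => // n; have [] := hk n.
have [N|h Gh hh] := dir_conj j.
  by have [k Nk hk] := away N; exists k => // n; have [] := hk n.
(* any lower bound [B] that outgrows [K] and [M] makes the final estimates
   incompatible *)
pose M := `[g] + `[h]; pose B := 3 * K + 10 * M + 100.
have g0 := mdist_ge0 o (g o); have h0 := mdist_ge0 o (h o).
have K0 : 0 <= K := le_trans (gromov_product_ge0 _ _ _) (aK i j 0%N 0%N ij).
have [n Bn zc] := hg (Num.truncn B).+1; have [m Bm wc] := hh (Num.truncn B).+1.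
have big i' l : ((Num.truncn B).+1 <= l)%N -> B <= `[a i' l].
  move=> Bl; apply: le_trans (a_big i' l); apply: le_trans (ltW (truncnS_gt _)) _.
  by rewrite ler_nat.
have {}Bn := big i n Bn; have {}Bm := big j m Bm.
set z := (a i n * g^-1)%g in zc; set w := (a j m * h^-1)%g in wc.
have Gz : Gam z by apply: (GM); last exact: GV.
have Gw : Gam w by apply: (GM); last exact: GV.
have [k Nk hk] := away (Num.truncn (`[a i n] + `[a j m] + 2)).+1.
have kR : `[a i n] + `[a j m] + 2 <= k%:R.
  by apply: le_trans (ltW (truncnS_gt _)) _; rewrite ler_nat.
have [xn xm] : gp (a i n o) (x k) <= K + 2 /\ gp (a j m o) (x k) <= K + 2.
  by have [? _] := hk n; have [_ ?] := hk m.
have near i' l (f u : isom X) : u = (a i' l * f^-1)%g -> Gam f ->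
    (forall v, Gam v -> commute u v) ->
    mdist (u o) (a i' l o) = `[f] /\ mdist ((u^-1)%g o) ((a i' l)^-1%g o) = `[f].
  move=> uE Gf uc; split.
    by rewrite uE isom_mulE isom_dist metric_sym disp_inv.
  have -> : (u^-1 = (a i' l)^-1 * f)%g.
    have e : (a i' l = u * f)%g by rewrite uE mulgVK.
    by apply: (@mulgI _ (a i' l)); rewrite mulVKg e (uc _ Gf) mulgK.
  by rewrite isom_mulE isom_dist metric_sym.
have [dz dzV] := near i n g z erefl Gg zc.
have [dw dwV] := near j m h w erefl Gh wc.
have mg : `[g] <= M by rewrite /M; lra.
have mh : `[h] <= M by rewrite /M; lra.
have B0 : B = 3 * K + 10 * M + 100 by [].
have an0 := mdist_ge0 o (a i n o); have am0 := mdist_ge0 o (a j m o).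
have toward i' l (f u : isom X) : gp (a i' l o) (x k) <= K + 2 ->
    `[a i' l] + 2 <= k%:R -> B <= `[a i' l] -> `[f] <= M ->
    mdist (u o) (a i' l o) = `[f] ->
    mdist ((u^-1)%g o) ((a i' l)^-1%g o) = `[f] ->
    [/\ gp (x k) (u o) <= K + 2 + M,
        K + M + 20 < gp (x k) ((u^-1)%g o) & B - M <= `[u]].
  move=> hxl kl Bl fM du duV.
  have e1 := almost_fixed_inv (hx k) (Ga i' l) hxl kl.
  have e2 := gromov_product_near o (x k) (u o) (a i' l o).
  have e3 := gromov_product_near o (x k) ((a i' l)^-1%g o) ((u^-1)%g o).
  have e4 := metric_triangle o (u o) (a i' l o).
  move: hxl e1; rewrite /gp !(gromov_productC _ _ (x k)) => hxl e1.
  by rewrite metric_sym duV in e3; rewrite du in e2 e4; split; lra.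
have kn : `[a i n] + 2 <= k%:R by lra.
have km : `[a j m] + 2 <= k%:R by lra.
have [z1 z2 z3] := toward i n g z xn kn Bn mg dz dzV.
have [w1 w2 w3] := toward j m h w xm km Bm mh dw dwV.
have zw : gp ((z^-1)%g o) (w o) <= K + 4 + M.
  have e : K + 2 + M + 2 < gp ((z^-1)%g o) (x k).
    by rewrite /gp gromov_productC; rewrite /gp in z2; lra.
  have w1' : gp (w o) (x k) <= K + 2 + M by rewrite /gp gromov_productC.
  have := four_point_le cat w1' e; rewrite gromov_productC /gp; lra.
have wz : gp ((w^-1)%g o) (z o) <= K + 4 + M.
  have e : K + 2 + M + 2 < gp ((w^-1)%g o) (x k).
    by rewrite /gp gromov_productC; rewrite /gp in w2; lra.
  have z1' : gp (z o) (x k) <= K + 2 + M by rewrite /gp gromov_productC.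
  have := four_point_le cat z1' e; rewrite gromov_productC /gp; lra.
have s1 := gromov_product_step z (w o); have s2 := gromov_product_step w (z o).
have e : z (w o) = w (z o) by rewrite -!isom_mulE (zc _ Gw).
rewrite -e in s2.
(* both [z o] and [w o] are close to the direction of [z w o = w z o] *)
have s3 : B - M - (K + 4 + M) - 2 <= gp (z o) (w o).
  apply: four_point_ge cat (_ : _ <= gp (z o) (z (w o))) _.
    by rewrite /gp s1; rewrite /gp in zw; lra.
  by rewrite /gp gromov_productC s2; rewrite /gp in wz; lra.
have s4 := gromov_product_near o (z o) (w o) (a j m o).
have s5 := gromov_product_near o (a j m o) (z o) (a i n o).
rewrite dw in s4; rewrite dz !(gromov_productC _ (a j m o)) in s5.
by have := aK i j n m ij; rewrite /gp in s3 *; lra.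
Qed.

End OrbitGrowth.

(** * Free subsemigroups of large exponent *)

Section Semigroup.
Context {R : realType} {X : metricType R}.
Variables (Gam : set (isom X)) (o : X).
Implicit Types (f g h : isom X) (F : seq (isom X)) (x y q : X).
Implicit Types (s t r a l C : R).

Local Notation "`[ g ]" := (mdist o (g o)) (at level 0, format "`[ g ]").
Local Notation gp := (gromov_product o).

(** Below the critical exponent the annuli of the orbit are infinitely often
    more populated than any fixed multiple of [expR (s * n)]: otherwise the
    Poincare series at a larger exponent [t] is dominated by a geometric
    series. *)
Lemma populated_annulus s t C (n0 : nat) : finite_balls Gam o ->
  0 < s -> s < t -> poincare Gam o t = +oo%E -> 0 <= C ->
  exists (n : nat) (A : seq (isom X)), [/\ (n0 <= n)%N, uniq A,
    forall g, g \in A -> Gam g /\ n%:R <= `[g] <= n%:R + 1 &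
    C * expR (s * n%:R) <= (size A)%:R].
Proof.
move=> fin s0 st pt C0; apply: contrapT => hno.
have /choice[A hA] : forall n : nat, exists A : seq (isom X), uniq A /\
    forall g, g \in A <-> Gam g /\ n%:R <= `[g] < n%:R + 1.
  move=> n; have [l [ul hl]] := fin (n%:R + 1).
  exists [seq g : isom X <- l | n%:R <= `[g] < n%:R + 1]; rewrite filter_uniq //; split => // g.
  rewrite mem_filter; split => [/andP[? /hl[]]|[Gg ng]] //.
  by rewrite ng; apply/hl; split => //; case/andP: ng => _ /ltW.
pose D := C + (\sum_(n < n0) size (A n))%:R.
have D0 : 0 <= D by rewrite addr_ge0.
have count_le n : (size (A n))%:R <= D * expR (s * n%:R).
  have [uA AE] := hA n; have e1 : 1 <= expR (s * n%:R).
    by rewrite -expR0 ler_expR mulr_ge0 // ltW.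
  have [nn0|n0n] := ltnP n n0.
    apply: le_trans (ler_peMr D0 e1); rewrite /D ler_wpDl // ler_nat.
    by rewrite (bigD1 (Ordinal nn0)) //= leq_addr.
  apply: le_trans (_ : C * expR (s * n%:R) <= _); last first.
    by rewrite ler_wpM2r ?expR_ge0 // /D lerDl.
  rewrite leNgt; apply/negP => hlt; apply: hno; exists n, (A n).
  split => //; last exact: ltW.
  by move=> g /AE[Gg /andP[h1 h2]]; rewrite h1 ltW.
pose q := expR (s - t).
have q0 : 0 < q by exact: expR_gt0.
have q1 : q < 1 by rewrite -expR0 ltr_expR subr_lt0.
suff bd (l : seq (isom X)) : uniq l -> (forall g, g \in l -> Gam g) ->
    \sum_(g <- l) expR (- (t * `[g])) <= D / (1 - q).
  have : (poincare Gam o t <= (D / (1 - q))%:E)%E.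
    apply: ge_ereal_sup => _ [B [fB BG] <-].
    rewrite fsbig_finite //= sumEFin lee_fin; apply: bd; first exact: fset_uniq.
    by move=> g; rewrite in_fset_set // inE; exact: BG.
  by rewrite pt leye_eq.
move=> ul lG; pose k g := Num.truncn `[g].
have [N hN] : exists N, forall g, g \in l -> (k g < N)%N.
  exists (\max_(g <- l) k g).+1 => g gl.
  by rewrite ltnS; apply: leq_bigmax_seq.
rewrite big_seq (partition_big (fun g => inord (k g) : 'I_N.+1) predT) //=.
apply: le_trans (_ : \sum_(j < N.+1) D * q ^+ j <= _); last first.
  rewrite -mulr_sumr ler_wpM2l // -[leRHS]div1r ler_pdivlMr ?subr_gt0 //.
  have := subrX1 q N.+1; have := exprn_ge0 N.+1 (ltW q0).
  by set S := \sum_(_ < _) _; lra.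
apply: ler_sum => j _.
have [uA AE] := hA j.
apply: le_trans (_ : (size (A j))%:R * expR (- (t * j%:R)) <= _); last first.
  apply: le_trans (ler_wpM2r (expR_ge0 _) (count_le j)) _.
  have -> : q ^+ j = expR (s * j%:R + - (t * j%:R)).
    by rewrite /q -expRM_natr; congr expR; ring.
  by rewrite expRD mulrA.
pose l' := [seq g : isom X <- l | inord (k g) == j :> 'I_N.+1].
have inl' g : g \in l' -> g \in A j.
  rewrite mem_filter => /andP[/eqP kj gl]; apply/AE; split; first exact: lG.
  have <- : k g = j by rewrite -kj inordK // ltnW // ltnS hN.
  by rewrite natr1; apply: truncn_itv; exact: mdist_ge0.
rewrite -big_seq_cond -big_filter -/l'.
apply: le_trans (_ : \sum_(g <- l') expR (- (t * j%:R)) <= _).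
  rewrite big_seq [leRHS]big_seq; apply: ler_sum => g /inl'/AE[_ /andP[jg _]].
  by rewrite ler_expR lerN2 ler_wpM2l // ltW // (lt_trans s0).
rewrite big_const_seq iter_addr_0 count_predT -[leLHS]mulr_natl.
rewrite ler_wpM2r ?expR_ge0 // ler_nat; apply: uniq_leq_size inl'.
exact: filter_uniq.
Qed.

(** The direction of [x] is recorded by the point at distance [r] on a geodesic
    from [o] to [x]; the ball of radius [r] has a finite net. *)
Lemma finite_directions r : proper_space X -> geodesic_space X -> 0 <= r ->
  exists Q : seq X, forall x, r <= mdist o x ->
    exists2 q, q \in Q & r - 1 <= gp x q.
Proof.
move=> prop geo r0.
have [Q hQ] := compact_finite_net (@ltr01 R) (prop o r).
exists Q => x rx; have [c [l pc]] := geo o x.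
have lx := geodesic_path_dist pc; rewrite lx in rx.
have hr : 0 <= r <= l by rewrite r0.
have l0 : 0 <= (0 : R) <= l by lra.
have c0 : c 0 = o by case: pc.
have [|q qQ hq] := hQ (c r).
  rewrite /= -[in leLHS]c0 (geodesic_path_sub pc l0 hr) sub0r normrN.
  by rewrite ger0_norm.
exists q => //; have := gromov_product_near o x (c r) q.
by rewrite (gromov_product_geodesic pc hr) metric_sym; lra.
Qed.

(** The elements of [F] generate a free semigroup whose words label
    quasi-geodesics: no long cancellation occurs between consecutive letters,
    and distinct letters start in distinct directions. *)
Definition ping_pong F a l : Prop :=
  [/\ uniq F,
      forall f, f \in F -> Gam f /\ 2 * a + 20 <= `[f] <= l,
      forall f g, f \in F -> g \in F -> gp ((f^-1)%g o) (g o) <= a &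
      forall f g, f \in F -> g \in F -> f != g ->
        gp (f o) (g o) + a + 20 <= `[f]].

Hypotheses (cat : cat_minus_one X) (prop : proper_space X).
Hypotheses (subG : is_subgroup Gam) (fin : finite_balls Gam o).

(** Among the elements of a populated annulus, keep those which move [o] in
    one direction [q] and whose inverses move [o] in one direction [q'], then a
    sparse subset of these.  Multiplying them by an element which moves [q']
    away from [q] removes all cancellation. *)
Lemma ping_pong_exists s t C : 0 < s -> s < t -> poincare Gam o t = +oo%E ->
  0 <= C ->
  (forall x y, exists m, [/\ Gam m, `[m] <= C & gp (m x) y <= C]) ->
  exists F a l, [/\ ping_pong F a l, 0 <= a & 1 <= (size F)%:R * expR (- (s * l))].
Proof.
move=> s0 st pt C0 move_apart; have [_ GM GV] := subG; have [geo _] := cat.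
(* [a] bounds the cancellation, [r] is the precision to which directions are
   specified, and two orbit points of one annulus at distance [d] separate
   long before their ends *)
pose a := 2 * C + 4; pose r := 2 * C + 20; pose d := 6 * C + 2 * a + 60.
have r0 : 0 <= r by rewrite /r; lra.
have [Q hQ] := finite_directions prop geo r0.
have [Bd [uBd BdE]] := fin d.
pose W := (size Q * size Q * size Bd).+1.
have C10 : 0 <= W%:R * expR (s * (1 + C)) by rewrite mulr_ge0 // expR_ge0.
have [n [A [n0 uA hA sA]]] := populated_annulus
  (Num.truncn (r + 2 * a + C + 20)).+1 fin s0 st pt C10.
have nR : r + 2 * a + C + 20 <= n%:R.
  by apply: le_trans (ltW (truncnS_gt _)) _; rewrite ler_nat.
pose P g (qq : X * X) := `[< r - 1 <= gp (g o) qq.1 /\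
  r - 1 <= gp ((g^-1)%g o) qq.2 >].
have [g gA|A0|[[q q'] _ hP]] := @finite_pigeonhole _ _
    [seq (q, q') | q <- Q, q' <- Q] P A.
- have [Gg /andP[ng _]] := hA g gA.
  have rg : r <= `[g] by move: ng; rewrite /r /a in nR *; lra.
  have [q qQ hq] := hQ (g o) rg.
  have [|q' qQ' hq'] := hQ ((g^-1)%g o); first by rewrite disp_inv.
  exists (q, q'); last exact/asboolP.
  by apply/allpairsP; exists (q, q').
- have W0 : 0 < W%:R :> R by rewrite ltr0n.
  move: sA; rewrite A0 /= leNgt.
  by rewrite (mulr_gt0 (mulr_gt0 W0 (expR_gt0 _)) (expR_gt0 _)).
rewrite size_allpairs in hP.
set A1 := [seq g : isom X <- A | _] in hP.
have hA1 g : g \in A1 -> [/\ Gam g, n%:R <= `[g] <= n%:R + 1,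
    r - 1 <= gp (g o) q & r - 1 <= gp ((g^-1)%g o) q'].
  by rewrite mem_filter => /andP[/asboolP[h1 h2] /hA[]].
pose close g h := mdist (g o) (h o) < d.
have [||||F0 [uF0 F0A F0s sF0]] := @sparse_sublist _ close (size Bd) A1.
- by move=> g h; rewrite /close metric_sym.
- exact: filter_uniq.
- by move=> g _; rewrite /close mdistxx /d /a; lra.
- move=> g /hA1[Gg _ _ _]; rewrite -size_filter.
  rewrite -(size_map (fun h => (g^-1 * h)%g) [seq x <- A1 | close g x]).
  apply: uniq_leq_size.
    by rewrite map_inj_uniq ?filter_uniq //; exact: mulgI.
  move=> _ /mapP[h + ->]; rewrite mem_filter => /andP[gh /hA1[Gh _ _ _]].
  apply/BdE; split; first by apply: (GM) => //; exact: GV.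
  rewrite isom_mulE -(isom_dist g) isom_invVK; exact: ltW.
have [m [Gm mC mq]] := move_apart q' q.
pose F := [seq (g * m^-1)%g | g : isom X <- F0].
have dm g : mdist (g o) ((g * m^-1)%g o) = `[m].
  by rewrite isom_mulE isom_dist disp_inv.
have hF0 g : g \in F0 -> [/\ Gam g, n%:R <= `[g] <= n%:R + 1,
    r - 1 <= gp (g o) q & r - 1 <= gp ((g^-1)%g o) q'].
  by move=> /F0A /hA1.
have disp g : g \in F0 -> n%:R - C <= `[(g * m^-1)%g] <= n%:R + 1 + C.
  move=> /hF0[_ ng _ _]; have := dm g; move: (g * m^-1)%g => f df.
  have := metric_triangle o (g o) (f o); have := metric_triangle o (f o) (g o).
  by rewrite (metric_sym (f o)) df; lra.
exists F, a, (n%:R + 1 + C); split; last 2 first.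
- by rewrite /a; lra.
- rewrite size_map.
  have h1 : (size A <= size Q * size Q * size Bd * size F0)%N.
    by apply: leq_trans hP _; rewrite -[leqRHS]mulnA leq_mul2l sF0 orbT.
  have h2 : W%:R * expR (s * (1 + C)) * expR (s * n%:R) <= W%:R * (size F0)%:R.
    apply: le_trans sA _; rewrite -natrM ler_nat; apply: leq_trans h1 _.
    by rewrite leq_mul2r /W leqnSn orbT.
  rewrite -mulrA ler_pM2l ?ltr0n // -expRD in h2.
  rewrite expRN ler_pdivlMr ?expR_gt0 // mul1r; apply: le_trans h2.
  by rewrite ler_expR; lra.
split.
- by rewrite map_inj_uniq //; exact: mulIg.
- move=> _ /mapP[g gF0 ->]; have [Gg _ _ _] := hF0 g gF0; split.
    by apply: (GM) => //; exact: GV.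
  by have := disp g gF0; rewrite /r /a in nR *; lra.
- move=> _ _ /mapP[g gF0 ->] /mapP[h hF ->].
  have [_ _ _ gq'] := hF0 g gF0; have [_ _ hq _] := hF0 h hF.
  rewrite invgM invgK isom_mulE.
  have e1 := gromov_product_near o (m ((g^-1)%g o)) ((h * m^-1)%g o) (h o).
  rewrite (metric_sym _ (h o)) dm in e1.
  have e2 : r - 1 - C <= gp (m ((g^-1)%g o)) (m q').
    have := gromov_product_base (m o) o (m ((g^-1)%g o)) (m q').
    by rewrite gromov_product_isom (metric_sym (m o)); lra.
  have e3 : gp q (m ((g^-1)%g o)) <= C + 2.
    apply: four_point_le cat (_ : gp q (m q') <= C) _; first by rewrite gromov_productC.
    by rewrite /r in e2; lra.
  have e4 : gp (m ((g^-1)%g o)) (h o) <= C + 2 + 2.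
    apply: four_point_le cat (_ : gp _ q <= C + 2) _; first by rewrite gromov_productC.
    by rewrite /r in hq; lra.
  by rewrite /a; lra.
- move=> _ _ /mapP[g gF0 ->] /mapP[h hF ->] ne.
  have gh : g != h by apply: contraNN ne => /eqP->.
  have far := F0s g h gF0 hF gh; rewrite /close -leNgt in far.
  have := disp g gF0; have := disp h hF; have := dm g; have := dm h.
  have [_ ng _ _] := hF0 g gF0; have [_ nh _ _] := hF0 h hF.
  move: (g * m^-1)%g (h * m^-1)%g => f f' df' df dispf' dispf.
  have e1 := gromov_product_near o (f o) (f' o) (h o).
  have e2 := gromov_product_near o (h o) (f o) (g o).
  rewrite metric_sym df' in e1; rewrite metric_sym df !(gromov_productC _ (h o)) in e2.
  have e3 : gp (g o) (h o) <= n%:R + 1 - d / 2.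
    by rewrite /gromov_product !(metric_sym _ o); lra.
  by rewrite /d /r /a in e3 nR *; lra.
Qed.

End Semigroup.

(** * Limit points *)

Section Rays.
Context {R : realType} {X : metricType R}.
Variable o : X.
Implicit Types (c d : R -> X) (A B xi eta : boundary X) (x y : X) (r s t : R).

Local Notation gp := (gromov_product o).

Lemma asymptotic_sym c d : asymptotic c d -> asymptotic d c.
Proof. by move=> [M hM]; exists M => t t0; rewrite metric_sym hM. Qed.

Lemma asymptotic_trans c d e : asymptotic c d -> asymptotic d e -> asymptotic c e.
Proof.
move=> [M hM] [N hN]; exists (M + N) => t t0.
by apply: le_trans (metric_triangle _ (d t) _) _; rewrite lerD ?hM ?hN.
Qed.

Lemma bclass_ray A c : bclass A c -> geodesic_ray c.
Proof. by have [d [_ ->]] := bclassP A => -[]. Qed.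

Lemma bclass_asymptotic A c d : bclass A c -> bclass A d -> asymptotic c d.
Proof.
have [e [_ ->]] := bclassP A => -[_ ec] [_ ed].
by apply: asymptotic_trans ed; exact: asymptotic_sym.
Qed.

Lemma boundary_eq A B c d : bclass A c -> bclass B d -> asymptotic c d -> A = B.
Proof.
move=> Ac Bd cd; suff e : bclass A = bclass B.
  case: A B e {Ac Bd} => cA pA [cB pB] /= e; subst cB.
  by congr Boundary; exact: Prop_irrelevance.
have incl A' B' c' d' : bclass A' c' -> bclass B' d' -> asymptotic c' d' ->
    bclass A' `<=` bclass B'.
  move=> Ac' Bd' cd' e Ae; have re := bclass_ray Ae.
  have ce := bclass_asymptotic Ac' Ae; move: Bd'.
  have [b [_ ->]] := bclassP B' => -[_ bd']; split => //.
  by apply: asymptotic_trans bd' (asymptotic_trans (asymptotic_sym cd') ce).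
apply/seteqP; split; first exact: incl Ac Bd cd.
exact: incl Bd Ac (asymptotic_sym cd).
Qed.

Lemma bray_class xi : bclass xi (bray xi).
Proof.
rewrite /bray; case: cid => c [rc e] /=; rewrite e; split => //.
by exists 0 => t _; rewrite mdistxx.
Qed.

Definition ray_point c (rc : geodesic_ray c) : boundary X :=
  @Boundary R X [set c' | geodesic_ray c' /\ asymptotic c c']
    (ex_intro _ c (conj rc erefl)).

Lemma ray_point_class c (rc : geodesic_ray c) : bclass (ray_point rc) c.
Proof. by split => //; exists 0 => t _; rewrite mdistxx. Qed.

Lemma ray_dist c t : geodesic_ray c -> c 0 = o -> 0 <= t -> mdist o (c t) = t.
Proof. by move=> rc c0 t0; rewrite -c0 rc // sub0r normrN ger0_norm. Qed.

Lemma ray_gromov_product c r t : geodesic_ray c -> c 0 = o -> 0 <= t <= r ->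
  gp (c t) (c r) = t.
Proof.
move=> rc c0 /andP[t0 tr]; have r0 := le_trans t0 tr.
rewrite /gromov_product !(metric_sym _ o) !ray_dist // (rc t r t0 r0).
by rewrite ler0_norm; lra.
Qed.

Hypothesis cat : cat_minus_one X.

Lemma rays_fellow_travel c d r s t : geodesic_ray c -> geodesic_ray d ->
  c 0 = o -> d 0 = o -> 0 <= t <= r -> t <= s -> t <= gp (c r) (d s) ->
  mdist (c t) (d t) <= 8.
Proof.
move=> rc rd c0 d0 tr ts tcd.
have h : t - 2 - 2 <= gp (c t) (d t).
  apply: four_point_ge cat (_ : _ <= gp (c t) (d s)) _.
    apply: four_point_ge cat (_ : _ <= gp (c t) (c r)) _ => //.
    by rewrite ray_gromov_product.
  by rewrite gromov_productC ray_gromov_product //; lra.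
by move: h; rewrite /gromov_product !(metric_sym _ o) !ray_dist //; lra.
Qed.

Lemma asymptotic_rays_close c d t : geodesic_ray c -> geodesic_ray d ->
  c 0 = o -> d 0 = o -> asymptotic c d -> 0 <= t -> mdist (c t) (d t) <= 8.
Proof.
move=> rc rd c0 d0 [M hM] t0; pose r := t + `|M|.
have r0 : 0 <= r by rewrite addr_ge0.
have tr : t <= r by rewrite lerDl.
have tr' : 0 <= t <= r by rewrite t0.
apply: (rays_fellow_travel rc rd c0 d0 tr' tr).
have := hM r r0; have := ler_norm M; have := normr_ge0 M; rewrite /gromov_product !(metric_sym _ o).
by rewrite !ray_dist // /r; lra.
Qed.

(** Basic neighbourhoods of [A] in terms of Gromov products; the ray is
    quantified because the definition of the limit set does not fix one. *)
Definition toward A r x : Prop :=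
  exists c, [/\ bclass A c, c 0 = o & r - 1 <= gp x (c r)].

Lemma toward_disp A r x : 0 <= r -> toward A r x -> r - 1 <= mdist o x.
Proof.
by move=> r0 [c [_ _ h]]; apply: le_trans h _; exact: gromov_product_lel.
Qed.

Lemma limit_set_toward (Gam : set (isom X)) A r : limit_set Gam o A ->
  0 <= r -> exists2 g, Gam g & toward A r (g o).
Proof.
move=> hA r0; have [g Gg [c [Ac c0 [a [l [pa rl h]]]]]] := hA r 1 r0 ltr01.
exists g => //; exists c; split => //.
have hr : 0 <= r <= l by rewrite r0 ltW.
have := gromov_product_near o (g o) (a r) (c r).
by rewrite (gromov_product_geodesic pa hr); lra.
Qed.

(** Distinct boundary points are visibly apart: otherwise rays issuing from
    [o] towards both would fellow travel forever. *)
Lemma toward_separated A B : A <> B ->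
  exists2 K, 0 <= K & forall r s x y, K <= r -> K <= s ->
    toward A r x -> toward B s y -> gp x y <= K.
Proof.
move=> AB; apply: contrapT => hno; apply: AB.
have close K : 0 <= K -> exists c d, [/\ bclass A c, bclass B d, c 0 = o, d 0 = o &
    forall t, 0 <= t <= K -> mdist (c t) (d t) <= 8].
  move=> K0; apply: contrapT => hc; apply: hno; exists (K + 5); first lra.
  move=> r s x y Kr Ks [c [Ac c0 hx]] [d [Bd d0 hy]].
  rewrite leNgt; apply/negP => hlt; apply: hc; exists c, d; split => // t tK.
  apply: (rays_fellow_travel (r := r) (s := s) (bclass_ray Ac) (bclass_ray Bd)) => //; try lra.
  apply: le_trans (_ : K <= _); first lra.
  have -> : K = K + 4 - 2 - 2 by ring.
  apply: four_point_ge cat (_ : _ <= gp (c r) y) _; last lra.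
  by apply: four_point_ge cat (_ : _ <= gp (c r) x) _;
    [rewrite gromov_productC; lra | lra].
have [c [d [Ac Bd c0 d0 _]]] := close 0 (lexx _).
apply: (boundary_eq Ac Bd); exists (8 + 8 + 8) => t t0.
have [c' [d' [Ac' Bd' c'0 d'0 h]]] := close t t0.
have h1 := asymptotic_rays_close (bclass_ray Ac) (bclass_ray Ac') c0 c'0
  (bclass_asymptotic Ac Ac') t0.
have h2 := asymptotic_rays_close (bclass_ray Bd) (bclass_ray Bd') d0 d'0
  (bclass_asymptotic Bd Bd') t0.
have h3 := metric_triangle (c t) (c' t) (d t).
have h4 := metric_triangle (c' t) (d' t) (d t).
have tt : 0 <= t <= t by rewrite t0 lexx.
by have := h t tt; rewrite (metric_sym (d' t)) in h4; lra.
Qed.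

(** The third limit point is provided by non-elementarity. *)
Lemma three_directions (Gam : set (isom X)) A B : limit_set Gam o A ->
  limit_set Gam o B -> A <> B -> non_elementary Gam o ->
  exists (a : 'I_3 -> nat -> isom X) (K : R), [/\
    forall i n, Gam (a i n), forall i n, n%:R <= mdist o (a i n o) &
    forall i j n m, i != j -> gp (a i n o) (a j m o) <= K].
Proof.
move=> lA lB AB ne.
have [C [lC CA CB]] : exists C, [/\ limit_set Gam o C, C <> A & C <> B].
  apply: contrapT => hno; apply: (ne A B) => C lC; apply: contrapT => hC.
  by apply: hno; exists C; split => // e; apply: hC; [left | right].
pose P := nth A [:: A; B; C].
have lP (i : 'I_3) : limit_set Gam o (P i) by case: i => [[|[|[|]]]].
have PP (i j : 'I_3) : i != j -> P i <> P j.
  by case: i j => [[|[|[|]]] ? //] [[|[|[|]]] ? //] _; rewrite /P /=;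
    do ?[by apply: nesym | by []].
have /choice[K hK] : forall ij : 'I_3 * 'I_3, exists K : R, 0 <= K /\
    (ij.1 != ij.2 -> forall r s x y, K <= r -> K <= s ->
      toward (P ij.1) r x -> toward (P ij.2) s y -> gp x y <= K).
  move=> [i j] /=; have [->|ij] := eqVneq i j; first by exists 0.
  by have [k k0 hk] := toward_separated (PP i j ij); exists k.
pose M := \sum_ij K ij.
have KM ij : K ij <= M.
  rewrite /M (bigD1 ij) //= lerDl sumr_ge0 // => kl _.
  by have [] := hK kl.
have M0 : 0 <= M by apply: sumr_ge0 => kl _; have [] := hK kl.
have /choice[a ha] : forall q : 'I_3 * nat, exists g,
    Gam g /\ toward (P q.1) (M + q.2%:R + 1) (g o).
  move=> q; have r0 : 0 <= M + q.2%:R + 1 by rewrite addr_ge0 // addr_ge0.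
  by have [g Gg hg] := limit_set_toward (lP q.1) r0; exists g.
exists (fun i n => a (i, n)), M; split => [i n|i n|i j n m ij].
- by have [] := ha (i, n).
- have [_ /= h] := ha (i, n); have n0 := ler0n R n.
  have := toward_disp (_ : 0 <= M + n%:R + 1) h; lra.
- have [_ /= hi] := ha (i, n); have [_ /= hj] := ha (j, m).
  have n0 := ler0n R n; have m0 := ler0n R m.
  have [_ /(_ ij) h] := hK (i, j); apply: le_trans (KM (i, j)).
  by apply: h hi hj; have := KM (i, j) => /=; lra.
Qed.

(** The limit, along an ultrafilter, of geodesics from [o] to the points of a
    sequence going to infinity. *)
Lemma limit_ray (y : nat -> X) : proper_space X ->
  (forall n, n%:R <= mdist o (y n)) ->
  exists c, [/\ geodesic_ray c, c 0 = o &
    forall t eps N, 0 <= t -> 0 < eps -> exists2 n, (N <= n)%N &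
      exists b l, [/\ geodesic_path b l o (y n), t < l & mdist (b t) (c t) < eps]].
Proof.
move=> prop hy; have [geo _] := cat.
have /choice[b /choice[l hb]] : forall n, exists b, exists l,
    geodesic_path b l o (y n) by move=> n; exact: geo.
have [U [UU UF]] := ultraFilterLemma (_ : ProperFilter (\oo)).
have ltl t : 0 <= t -> U [set n | t < l n].
  move=> t0; apply: UF; exists (Num.truncn t).+1 => // n /= tn.
  have <- := geodesic_path_dist (hb n); apply: lt_le_trans (hy n).
  by apply: lt_le_trans (truncnS_gt _) _; rewrite ler_nat.
have /choice[c hc] : forall t, exists p, 0 <= t ->
    forall eps, 0 < eps -> U [set n | mdist (b n t) p < eps].
  move=> t; have [t0|] := boolP (0 <= t); last by exists o.
  have FU : ProperFilter ((b ^~ t) @ U) by exact: fmap_proper_filter.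
  have [] := prop o t _ FU.
    rewrite /fmap /=; apply: filterS (ltl t t0) => n /= tl.
    have tl' : 0 <= t <= l n by rewrite t0 ltW.
    have [l0 b0 _ _] := hb n.
    have -> : mdist o (b n t) = t; last exact: lexx.
    rewrite -[in LHS]b0 (geodesic_path_sub (hb n)) ?lexx ?l0 //.
    by rewrite sub0r normrN ger0_norm.
  move=> p [_ clp]; exists p => _ eps e0.
  have [//|hC] := in_ultra_setVsetC [set n | mdist (b n t) p < eps] UU.
  have FC : (b ^~ t @ U) (~` ball p eps).
    rewrite /fmap /=; apply: filterS hC => n /=.
    by rewrite ballEmdist /= metric_sym.
  by have [z [z1 z2]] := clp _ _ FC (nbhsx_ballx p _ e0).
have near t eps N : 0 <= t -> 0 < eps ->
    U [set n | [/\ (N <= n)%N, t < l n & mdist (b n t) (c t) < eps]].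
  move=> t0 e0; have UN : U [set n | (N <= n)%N] by apply: UF; exists N.
  by apply: filterS (filterI UN (filterI (ltl t t0) (hc t t0 eps e0))) => n [? []].
exists c; split.
- move=> s t s0 t0; apply/eqP; rewrite -subr_eq0 -normr_le0.
  apply/ler_addgt0Pr => e e0; have e20 : 0 < e / 2 by lra.
  have [n [[_ sl hs] [_ tl ht]]] :=
    @filter_ex _ _ _ _ (filterI (near s _ 0%N s0 e20) (near t _ 0%N t0 e20)).
  have sl' : 0 <= s <= l n by rewrite s0 ltW.
  have tl' : 0 <= t <= l n by rewrite t0 ltW.
  have d := geodesic_path_sub (hb n) sl' tl'.
  have h1 := metric_triangle (c s) (b n s) (c t).
  have h2 := metric_triangle (b n s) (b n t) (c t).
  have h3 := metric_triangle (b n s) (c s) (b n t).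
  have h4 := metric_triangle (c s) (c t) (b n t).
  rewrite (metric_sym (c s) (b n s)) in h1; rewrite (metric_sym (c t) (b n t)) in h4.
  by rewrite add0r ler_norml -d; lra.
- apply: mdist_positivity; apply/eqP; rewrite -normr_le0 ger0_norm ?mdist_ge0 //.
  apply/ler_addgt0Pr => e e0.
  have [n [_ _ h]] := @filter_ex _ _ _ _ (near 0 e 0%N (lexx _) e0).
  have [_ b0 _ _] := hb n.
  by rewrite add0r metric_sym -b0 ltW.
- move=> t eps N t0 e0; have [n [Nn tl h]] := @filter_ex _ _ _ _ (near t eps N t0 e0).
  by exists n => //; exists (b n), (l n); split.
Qed.

End Rays.

(** * Hausdorff dimension of limit sets of free semigroups *)

Section CodedSets.
Context {R : realType} {T : Type} {U : eqType}.
Variables (rho : T -> T -> R) (Lam : set T) (F : seq U) (x : (nat -> U) -> T).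
Implicit Types (alp bet : nat -> U) (w : seq U).

Definition code alp : Prop := forall i, alp i \in F.

(** The mass distribution principle for a set coded by the infinite words in
    [F], in its combinatorial form: give a cylinder of depth [k] the weight
    [(lam `^ s) ^+ k].  A subset of the coded set lies in a cylinder whose
    weight is controlled by its diameter, and a family of cylinders of total
    weight less than one leaves out an infinite word, found letter by letter. *)
Lemma hausdorff_measure_coded_neq0 (s lam c : R) : uniq F ->
  0 < s -> 0 < lam < 1 -> 0 < c ->
  1 <= (size F)%:R * lam `^ s ->
  (forall alp, code alp -> Lam (x alp)) ->
  (forall alp bet k, code alp -> code bet ->
    (forall i, (i < k)%N -> alp i = bet i) -> alp k <> bet k ->
    c * lam ^+ k <= rho (x alp) (x bet)) ->
  hausdorff_measure rho s Lam <> 0%E.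
Proof.
move=> uF s0 /andP[lam0 lam1] c0 massF xLam sep H0.
have [|_ [U_ [cov diam1] <-] small] :=
    @ereal_inf_lt R [set (\sum_(0 <= n <oo) (diameter rho (V n)) `^ s)%E | V in
      [set V : nat -> set T | Lam `<=` \bigcup_n V n /\
        forall n, (diameter rho (V n) <= 1%:E)%E]] ((c `^ s / 2)%:E).
  apply: le_lt_trans (_ : (0 < _)%E); last by rewrite lte_fin divr_gt0 // powR_gt0.
  by rewrite -[leRHS]H0; apply: ereal_sup_ubound; exists 1 => //=; exact: ltr01.
pose D n := fine (diameter rho (U_ n)).
have diam0 n : (0 <= diameter rho (U_ n))%E.
  by apply: ereal_sup_ubound; left.
have DE n : diameter rho (U_ n) = (D n)%:E.
  rewrite /D fineK // ge0_fin_numE //.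
  by apply: le_lt_trans (diam1 n) _; exact: ltry.
have D0 n : 0 <= D n by rewrite -lee_fin -DE.
have rhoD n a b : U_ n a -> U_ n b -> rho a b <= D n.
  move=> ha hb; rewrite -lee_fin -DE; apply: ereal_sup_ubound; right.
  by exists a => //; exists b.
pose p := lam `^ s.
have p0 : 0 < p by rewrite powR_gt0.
have p1 : p < 1.
  have -> : 1 = 1 `^ s :> R by rewrite powR1.
  by apply: gt0_ltr_powR; rewrite ?nnegrE ?ltW.
have pX k : (lam ^+ k) `^ s = p ^+ k.
  rewrite /p -(powR_mulrn k (ltW lam0)) -(powR_mulrn k (powR_ge0 lam s)).
  by rewrite -!powRrM mulrC.
(* the second summand keeps [W n] positive when [U_ n] is a single point *)
pose W n := (D n / c) `^ s + 1 / 2 / (2 ^ n.+1)%:R.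
have W0 n : 0 < W n by rewrite ltr_wpDl ?powR_ge0 // divr_gt0 // ltr0n expn_gt0.
have sumW : (\sum_(0 <= n <oo) (W n)%:E < 1)%E.
  apply: le_lt_trans (@epsilon_trick R (fun n => ((D n / c) `^ s)%:E) (1/2) predT _ _) _.
  - by move=> n; rewrite lee_fin powR_ge0.
  - lra.
  have -> : (\sum_(0 <= n <oo) ((D n / c) `^ s)%:E =
      (c `^ s)^-1%:E * \sum_(0 <= n <oo) (diameter rho (U_ n)) `^ s)%E.
    rewrite -nneseriesZl; last by move=> n _; exact: poweR_ge0.
    apply: eq_eseriesr => n _; rewrite DE poweR_EFin -EFinM mulrC.
    by rewrite powRM ?invr_ge0 ?(ltW c0) // -powR_inv1 ?(ltW c0) // -powRrM mulN1r powRN.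
  set S := limn _ in small *.
  have S0 : (0 <= S)%E by apply: nneseries_ge0 => n _ _; exact: poweR_ge0.
  have : S \is a fin_num by rewrite ge0_fin_numE // (lt_trans small) // ltry.
  move: S S0 small => [v| |] // _; rewrite lte_fin => small _.
  rewrite -EFinM -EFinD lte_fin -ltrBrDr -ltr_pdivlMl ?invr_gt0 ?powR_gt0 //.
  by rewrite invrK; lra.
have kP n : exists k, p ^+ k <= W n.
  have [||k _ hk] := @cvg_expr R p _ [set z | `|0 - z| < W n].
  - by rewrite gtr0_norm.
  - exact: nbhsx_ballx.
  exists k; have := hk k (leqnn k) => /=.
  by rewrite sub0r normrN gtr0_norm ?exprn_gt0 // => /ltW.
pose kn n := ex_minn (kP n).
have knP n : p ^+ kn n <= W n by rewrite /kn; case: ex_minnP.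
have kn_min n j : p ^+ j <= W n -> (kn n <= j)%N.
  by rewrite /kn; case: ex_minnP => k _ h /h.
have agree n alp bet i : code alp -> code bet -> U_ n (x alp) -> U_ n (x bet) ->
    (i < kn n)%N -> alp i = bet i.
  move=> ca cb ha hb; apply: contraPP => ne; apply/negP; rewrite -leqNgt.
  have ex : exists i, alp i != bet i by exists i; apply/eqP.
  have [j jne jmin] := ex_minnP ex.
  apply: leq_trans (_ : j <= _)%N; last by apply: jmin; apply/eqP.
  have eqj k : (k < j)%N -> alp k = bet k.
    move=> kj; apply/eqP; apply: contraTT kj => ne'; rewrite -leqNgt; exact: jmin.
  apply: kn_min; apply: le_trans (_ : (D n / c) `^ s <= _); last first.
    by rewrite lerDl divr_ge0.
  rewrite -pX; apply: ge0_ler_powR; first exact: ltW.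
  - by rewrite nnegrE exprn_ge0 // ltW.
  - by rewrite nnegrE divr_ge0 // ltW.
  rewrite ler_pdivlMr // mulrC; apply: le_trans (rhoD n _ _ ha hb).
  by apply: sep => //; apply/eqP.
(* [light w] says that the cylinders of depth at least [size w] through [w] do
   not have enough mass to fill the cylinder of [w]; in particular [w] is not
   one of them *)
pose meets w n := `[< exists alp, [/\ code alp, U_ n (x alp),
  mkseq alp (size w) = w & (size w <= kn n)%N] >].
pose mass w : \bar R := (\sum_(0 <= n <oo) (if meets w n then p ^+ kn n else 0)%:E)%E.
pose light w := (mass w < (p ^+ size w)%:E)%E.
have term0 w n : (0 <= (if meets w n then p ^+ kn n else 0)%:E)%E.
  by rewrite lee_fin; case: ifP => // _; rewrite exprn_ge0 // ltW.
have light_nil : light [::].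
  rewrite /light /mass expr0; apply: le_lt_trans sumW; apply: lee_nneseries => //.
  by move=> n _; rewrite lee_fin; case: ifP => _; [exact: knP | exact: ltW].
have light_step w : exists f, light w -> f \in F /\ light (rcons w f).
  have F0 : F <> [::] by move=> F0; move: massF; rewrite F0 mul0r ler10.
  have [f0 f0F] : exists f0, f0 \in F.
    by case: F F0 => // f0 ? _; exists f0; rewrite mem_head.
  have [lw|] := boolP (light w); last by exists f0.
  apply: contrapT => hno.
  have heavy f : f \in F -> ((p ^+ (size w).+1)%:E <= mass (rcons w f))%E.
    move=> fF; rewrite leNgt; apply/negP => hl; apply: hno; exists f => _.
    by rewrite /light size_rcons.
  move: lw; rewrite /light ltNge => /negP; apply.
  apply: le_trans (_ : (\sum_(f <- F) mass (rcons w f) <= _)%E).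
    apply: le_trans (_ : (\sum_(f <- F) (p ^+ (size w).+1)%:E <= _)%E).
      rewrite sumEFin lee_fin big_const_seq iter_addr_0 count_predT.
      rewrite -[leRHS]mulr_natl exprS mulrA ler_peMl //.
      by rewrite exprn_ge0 // ltW.
    by rewrite big_seq [leRHS]big_seq; apply: lee_sum => f; exact: heavy.
  rewrite /mass -nneseries_sum; last by move=> f n _; exact: term0.
  apply: lee_nneseries => [n _ _|n _]; first by apply: sume_ge0 => f _; exact: term0.
  have sub f : meets (rcons w f) n -> meets w n.
    move=> /asboolP[alp [ca ha]]; rewrite size_rcons mkseqS => /rcons_inj[e _] hk.
    by apply/asboolP; exists alp; split => //; exact: ltnW.
  have [[f [fF mf]]|no] := pselect (exists f, f \in F /\ meets (rcons w f) n).
    rewrite (bigD1_seq f) //= mf (sub f mf) big_seq_cond big1 ?adde0 //.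
    move=> g /andP[gF gf]; case: ifP => // /asboolP[bet [cb hb]].
    rewrite size_rcons mkseqS => /rcons_inj[eb gb] hk; exfalso.
    move: mf => /asboolP[alp [ca ha]]; rewrite size_rcons mkseqS => /rcons_inj[ea fa] _.
    move/eqP: gf; apply; rewrite -gb -fa; apply/esym.
    by apply: (agree n).
  rewrite big_seq big1 // => f fF; case: ifP => // mf; exfalso.
  by apply: no; exists f.
have [phi hphi] := choice light_step.
pose node := fix node m := if m is m'.+1 then rcons (node m') (phi (node m')) else [::].
pose alp m := phi (node m).
have light_node m : light (node m).
  by elim: m => //= m ih; have [] := hphi _ ih.
have calp : code alp by move=> m; have [] := hphi _ (light_node m).
have nodeE m : node m = mkseq alp m.
  by elim: m => // m ih; rewrite mkseqS -ih.
have [n _ Un] := cov _ (xLam _ calp).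
have := light_node (kn n); rewrite /light nodeE size_mkseq ltNge => /negP; apply.
rewrite /mass.
have := @nneseries_lim_ge R (fun j => (if meets (mkseq alp (kn n)) j then p ^+ kn j else 0)%:E)
  predT 0%N n.+1 (fun j _ _ => term0 _ j).
apply: le_trans; rewrite big_nat_recr //=.
have -> : meets (mkseq alp (kn n)) n.
  by apply/asboolP; exists alp; rewrite size_mkseq.
by rewrite leeDr // sume_ge0.
Qed.

End CodedSets.

(** * The limit set has dimension at least the critical exponent *)

Section WordPaths.
Context {R : realType} {X : metricType R}.
Variables (Gam : set (isom X)) (o : X).
Implicit Types (F : seq (isom X)) (a l : R) (f g : isom X) (alp bet : nat -> isom X) (xi eta : boundary X).

Local Notation "`[ g ]" := (mdist o (g o)) (at level 0, format "`[ g ]").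
Local Notation gp := (gromov_product o).

(** The recursion removes the first letter, since estimates are propagated by
    prepending a letter. *)
Fixpoint word alp n : isom X :=
  if n is n'.+1 then (alp 0%N * word (fun i => alp i.+1) n')%g else 1%g.

Lemma wordS alp n x : word alp n.+1 x = alp 0%N (word (fun i => alp i.+1) n x).
Proof. by []. Qed.

Hypotheses (cat : cat_minus_one X) (subG : is_subgroup Gam).
Hypothesis prop : proper_space X.

Lemma code_tail F alp : code F alp -> code F (fun i => alp i.+1).
Proof. by move=> ca i; exact: ca. Qed.

Lemma word_in F a l alp n :
  ping_pong Gam o F a l -> 0 <= a -> code F alp -> Gam (word alp n).
Proof.
move=> ppF a0; have [G1 GM _] := subG; have [_ FG _ _] := ppF.
elim: n alp => [|n ih] alp ca //=.
by apply: (GM); [have [] := FG _ (ca 0%N) | exact/ih/code_tail].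
Qed.

(** Each letter is much longer than the part of it which can cancel. *)
Lemma word_cancellation F a l f alp n :
  ping_pong Gam o F a l -> 0 <= a -> f \in F -> code F alp ->
  gp ((f^-1)%g o) (word alp n o) <= a + 2.
Proof.
move=> ppF a0; have [_ FG Fa _] := ppF.
elim: n f alp => [|n ih] f alp fF ca.
  apply: le_trans (gromov_product_ler _ _ _) _.
  have -> : word alp 0 o = o by [].
  by rewrite mdistxx addr_ge0.
apply: four_point_le cat (_ : gp _ (alp 0%N o) <= a) _; first exact: Fa.
rewrite wordS gromov_productC gromov_product_step.
have [_ /andP[h _]] := FG _ (ca 0%N).
have := ih (alp 0%N) _ (ca 0%N) (code_tail ca). lra.
Qed.

Lemma word_start F a l alp n :
  ping_pong Gam o F a l -> 0 <= a -> code F alp ->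
  `[alp 0%N] - (a + 2) <= gp (alp 0%N o) (word alp n.+1 o).
Proof.
move=> ppF a0 ca; rewrite wordS gromov_product_step lerD2l lerN2.
exact: word_cancellation ppF a0 (ca 0%N) (code_tail ca).
Qed.

Lemma word_disp F a l alp n :
  ping_pong Gam o F a l -> 0 <= a -> code F alp -> n%:R <= `[word alp n].
Proof.
move=> ppF a0; have [_ FG _ _] := ppF; elim: n alp => [|n ih] alp ca; first exact: mdist_ge0.
have := ih _ (code_tail ca); 
have := word_cancellation n ppF a0 (ca 0%N) (code_tail ca).
have [_ /andP[h _]] := FG _ (ca 0%N).
set v := word _ n o; have e : mdist (((alp 0%N)^-1)%g o) v = `[word alp n.+1].
  by rewrite -(isom_dist (alp 0%N)) isom_invVK.
rewrite /gromov_product !(metric_sym _ o) disp_inv e -[n.+1%:R]natr1; lra.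
Qed.

(** The common prefix contributes at most [l] per letter, and beyond it the
    words follow their first distinct letters, which diverge at once. *)
Lemma word_separation F a l k alp bet n m :
  ping_pong Gam o F a l -> 0 <= a -> code F alp -> code F bet ->
  (forall i, (i < k)%N -> alp i = bet i) -> alp k <> bet k ->
  (k < n)%N -> (k < m)%N ->
  gp (word alp n o) (word bet m o) <= k.+1%:R * l.
Proof.
move=> ppF a0; have [_ FG _ Fsep] := ppF.
elim: k alp bet n m => [|k ih] alp bet [|n] // [|m] // ca cb eqi ne kn km.
  rewrite mul1r; have /eqP ne' := ne.
  have := Fsep _ _ (ca 0%N) (cb 0%N) ne'.
  have := Fsep _ _ (cb 0%N) (ca 0%N); rewrite eq_sym gromov_productC => /(_ ne').
  have [_ /andP[_ h]] := FG _ (ca 0%N).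
  have ha := word_start n ppF a0 ca; have hb := word_start m ppF a0 cb.
  set e := gp (alp 0%N o) (bet 0%N o) => s1 s2.
  have h1 : gp (alp 0%N o) (word bet m.+1 o) <= e + 2.
    apply: four_point_le cat (_ : gp _ (bet 0%N o) <= e) _ => //.
    by rewrite gromov_productC; lra.
  have h2 : gp (word bet m.+1 o) (word alp n.+1 o) <= e + 2 + 2.
    apply: four_point_le cat (_ : gp _ (alp 0%N o) <= e + 2) _.
      by rewrite gromov_productC.
    by rewrite gromov_productC; lra.
  by rewrite gromov_productC; lra.
rewrite !wordS -(eqi 0%N) // -[k.+2%:R]natr1 mulrDl mul1r.
apply: le_trans (gromov_product_base _ (alp 0%N o) _ _) _.
rewrite gromov_product_isom; apply: lerD; last first.
  by have [_ /andP[_ h]] := FG _ (ca 0%N).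
by apply: ih => // i ik; exact: eqi.
Qed.

(** The limit point of an infinite word; the ray towards it from [o] comes
    close to geodesics from [o] to the partial products. *)
Lemma word_limit F a l alp :
  ping_pong Gam o F a l -> 0 <= a -> code F alp -> exists xi, limit_set Gam o xi /\
  exists c, [/\ bclass xi c, geodesic_ray c, c 0 = o &
    forall t N, 0 <= t -> exists2 n, (N <= n)%N & t - 1 <= gp (c t) (word alp n o)].
Proof.
move=> ppF a0 ca.
have [c [rc c0 hc]] := limit_ray cat prop (fun n => word_disp n ppF a0 ca).
exists (ray_point rc); split.
  move=> r eps r0 e0; have [n _ [b [k [pb rk hb]]]] := hc r eps 0%N r0 e0.
  exists (word alp n); first exact: word_in ppF a0 ca.
  by exists c; split => //; [exact: ray_point_class | exists b, k].
exists c; split => //; first exact: ray_point_class.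
move=> t N t0; have [n Nn [b [k [pb tk hb]]]] := hc t 1 N t0 ltr01.
exists n => //; have ht : 0 <= t <= k by rewrite t0 ltW.
have := gromov_product_near o (word alp n o) (b t) (c t).
by rewrite (gromov_product_geodesic pb ht) (gromov_productC _ _ (c t)); lra.
Qed.

(** The boundary Gromov product is a limit of Gromov products along rays, or
    zero should these not converge. *)
Lemma bourdon_metric_ge xi eta K : 0 <= K ->
  (exists M, forall t, M <= t -> gp (bray xi t) (bray eta t) <= K) ->
  expR (- K) <= bourdon_metric o xi eta.
Proof.
move=> K0 [M hM]; rewrite /bourdon_metric.
set L := boundary_gromov_product o xi eta.
have [L0 LK] : (0 <= L)%E /\ (L <= K%:E)%E.
  rewrite /L /boundary_gromov_product.
  set G := (X in lim X).
  have [cv|/dvgP ->] := pselect (cvg G); last by rewrite lee_fin.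
  split; [apply: lime_ge cv _ | apply: lime_le cv _].
    by apply: nearW => t; rewrite lee_fin gromov_product_ge0.
  near=> t; rewrite lee_fin; apply: hM; near: t.
  by apply: nbhs_pinfty_ge; exact: num_real.
move: L L0 LK => [v| |] //= _; rewrite lee_fin => vK.
by rewrite ler_expR lerN2.
Unshelve. all: by end_near.
Qed.

(** The rays chosen in the classes [xi] and [eta] need not start at [o], but they
    eventually point in the same directions as [c] and [d], hence as long
    prefixes of the two words. *)
Lemma word_limits_separated F a l alp bet k xi eta c d :
  ping_pong Gam o F a l -> 0 <= a -> code F alp -> code F bet ->
  (forall i, (i < k)%N -> alp i = bet i) -> alp k <> bet k ->
  bclass xi c -> c 0 = o -> bclass eta d -> d 0 = o ->
  (forall t N, 0 <= t ->
    exists2 n, (N <= n)%N & t - 1 <= gp (c t) (word alp n o)) ->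
  (forall t N, 0 <= t ->
    exists2 n, (N <= n)%N & t - 1 <= gp (d t) (word bet n o)) ->
  expR (- (l + 8)) * expR (- l) ^+ k <= bourdon_metric o xi eta.
Proof.
move=> ppF a0 ca cb eqi ne xic c0 etad d0 hc hd.
have [_ FG _ _] := ppF; have [_ /andP[l1 l2]] := FG _ (ca 0%N).
have l0 : 0 <= l by lra.
pose K := k.+1%:R * l + 8; have K0 : 0 <= K by rewrite /K addr_ge0 // mulr_ge0.
have -> : expR (- (l + 8)) * expR (- l) ^+ k = expR (- K).
  by rewrite -expRM_natr -expRD /K -[k.+1%:R]natr1; congr expR; ring.
apply: bourdon_metric_ge (K0) _.
have [M1 h1] := bclass_asymptotic (bray_class xi) xic.
have [M2 h2] := bclass_asymptotic (bray_class eta) etad.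
exists (K + 20 + `|M1| + `|M2|) => t ht.
have n1 := normr_ge0 M1; have n2 := normr_ge0 M2.
have a1 := ler_norm M1; have a2 := ler_norm M2.
have t0 : 0 <= t by lra.
have far zeta e M : bclass zeta e -> e 0 = o -> mdist (bray zeta t) (e t) <= M ->
    t - M <= gp (bray zeta t) (e t).
  move=> ze e0 h; have := metric_triangle o (bray zeta t) (e t).
  rewrite (ray_dist (bclass_ray ze) e0 t0) /gromov_product !(metric_sym _ o).
  by rewrite (ray_dist (bclass_ray ze) e0 t0); lra.
have f1 := far _ _ _ xic c0 (h1 t t0); have f2 := far _ _ _ etad d0 (h2 t t0).
have [n kn hn] := hc t k.+1 t0; have [m km hm] := hd t k.+1 t0.
have KE : k.+1%:R * l = K - 8 by rewrite /K; ring.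
have e0 := word_separation ppF a0 ca cb eqi ne kn km; rewrite KE in e0.
have e1 : gp (word bet m o) (c t) <= K - 8 + 2.
  by apply: four_point_le cat (_ : gp _ (word alp n o) <= K - 8) _;
    [rewrite gromov_productC | lra].
have e2 : gp (c t) (d t) <= K - 8 + 2 + 2.
  by apply: four_point_le cat (_ : gp _ (word bet m o) <= K - 8 + 2) _;
    [rewrite gromov_productC | lra].
have e3 : gp (d t) (bray xi t) <= K - 8 + 2 + 2 + 2.
  by apply: four_point_le cat (_ : gp _ (c t) <= K - 8 + 2 + 2) _;
    [rewrite gromov_productC | lra].
have e4 : gp (bray xi t) (bray eta t) <= K - 8 + 2 + 2 + 2 + 2.
  by apply: four_point_le cat (_ : gp _ (d t) <= K - 8 + 2 + 2 + 2) _;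
    [rewrite gromov_productC | lra].
by apply: le_trans e4 _; lra.
Qed.

End WordPaths.

Section Dimension.
Context {R : realType} {X : metricType R}.
Variables (Gam : set (isom X)) (o : X).

Hypotheses (cat : cat_minus_one X) (prop : proper_space X).
Hypotheses (subG : is_subgroup Gam) (fgG : finitely_generated Gam).
Hypotheses (neG : non_elementary Gam o).
Hypothesis finG : (critical_exponent Gam o < +oo)%E.

Lemma poincare_above s : (critical_exponent Gam o < s%:E)%E ->
  (poincare Gam o s < +oo)%E.
Proof.
move=> /ereal_inf_lt[_ [t [t0 pt] <-]]; rewrite lte_fin => ts.
exact: le_lt_trans (poincare_le Gam o (ltW ts)) pt.
Qed.

Lemma poincare_below s : 0 < s -> (s%:E < critical_exponent Gam o)%E ->
  poincare Gam o s = +oo%E.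
Proof.
move=> s0 sd; apply/eqP; rewrite -leye_eq leNgt; apply/negP => ps.
move: sd; rewrite ltNge => /negP; apply.
by apply: ereal_inf_lbound; exists s.
Qed.

Lemma discrete_finite_balls : finite_balls Gam o.
Proof.
have [_ [s [s0 ps] <-] _] := ereal_inf_lt finG.
exact: poincare_finite_balls (ltW s0) ps.
Qed.

(** For [s] below the critical exponent, the group contains free semigroups
    whose coded limit sets have positive [s]-dimensional measure. *)
Lemma critical_exponent_le_dim A B : limit_set Gam o A -> limit_set Gam o B ->
  A <> B ->
  (critical_exponent Gam o <= hausdorff_dim (bourdon_metric o) (limit_set Gam o))%E.
Proof.
move=> lA lB AB; have fin := discrete_finite_balls.
have [a [K [Ga a_big aK]]] := three_directions cat lA lB AB neG.
have [C C0 move_apart] := visible_motion cat subG fin fgG Ga a_big aK.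
apply: le_ereal_inf_tmp => _ [s [s0 Hs] <-]; rewrite leNgt; apply/negP => sd.
have [t st td] : exists2 t, s < t & (t%:E < critical_exponent Gam o)%E.
  move: finG sd; case: (critical_exponent Gam o) => [d| |] // _.
  by rewrite lte_fin => sd; exists ((s + d) / 2); rewrite ?lte_fin; lra.
have pt := poincare_below (lt_trans s0 st) td.
have [F [b [l [ppF b0 mass]]]] := ping_pong_exists cat prop subG fin s0 st pt C0 move_apart.
have [_ FG _ _] := ppF.
have /choice[x hx] : forall alp : nat -> isom X, exists xi, code F alp ->
    limit_set Gam o xi /\ exists c, [/\ bclass xi c, geodesic_ray c, c 0 = o &
      forall t N, 0 <= t -> exists2 n, (N <= n)%N &
        t - 1 <= gromov_product o (c t) (word alp n o)].
  move=> alp; have [ca|nc] := pselect (code F alp).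
    by have [xi hxi] := word_limit cat subG prop ppF b0 ca; exists xi.
  by exists A => ca.
have F0 : exists f, f \in F.
  case: F mass {ppF FG hx} => [|f F'] mass; last by exists f; rewrite mem_head.
  by move: mass; rewrite mul0r ler10.
have [f fF] := F0; have [_ /andP[l1 l2]] := FG f fF.
have l0 : 0 < l by lra.
apply: (@hausdorff_measure_coded_neq0 R _ _ (bourdon_metric o) (limit_set Gam o) F x s
  (expR (- l)) (expR (- (l + 8)))) => //.
- by case: ppF.
- by rewrite expR_gt0 -expR0 ltr_expR; lra.
- exact: expR_gt0.
- apply: le_trans mass _; rewrite ler_wpM2l // /powR expR_eq0 expRK.
  by rewrite ler_expR; lra.
- by move=> alp /hx[].
- move=> alp bet k ca cb eqi ne.
  have [_ [c [xc _ c0 hc]]] := hx alp ca; have [_ [d [xd _ d0 hd]]] := hx bet cb.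
  exact: (word_limits_separated cat ppF b0 ca cb eqi ne xc c0 xd d0 hc hd).
Qed.

End Dimension.

(** * Reduced words in a graph of groups *)

Section Walks.
Context {V E : Type} (Y : graph V E).
Implicit Types (u v w : V) (e f : E) (s : seq E).

Definition rev_walk s : seq E := [seq einv Y e | e <- rev s].

Lemma rev_walk_cons e s : rev_walk (e :: s) = rcons (rev_walk s) (einv Y e).
Proof. by rewrite /rev_walk rev_cons map_rcons. Qed.

Lemma walk_cat u v w s1 s2 : walk Y u s1 v -> walk Y v s2 w ->
  walk Y u (s1 ++ s2) w.
Proof. by elim: s1 u => /= [u ->|e s1 ih u [<- h] h2]; last by split; [|exact: ih]. Qed.

Lemma walk_rev u v s : walk Y u s v -> walk Y v (rev_walk s) u.
Proof.
elim: s u => [u ->|e s ih u [<- /ih h]] //.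
rewrite rev_walk_cons -cats1; apply: walk_cat h _ => /=; split => //.
by rewrite /ter einvK.
Qed.

Lemma no_backtrack_cat e f s1 s2 : no_backtrack Y (rcons s1 e) ->
  no_backtrack Y (f :: s2) -> f <> einv Y e ->
  no_backtrack Y (rcons s1 e ++ f :: s2).
Proof.
move=> + h2 fe; elim: s1 => [|a [|b s1] ih] //= [h] h1.
  by split => //; apply: (ih h1).
by split => //; apply: ih.
Qed.

Lemma no_backtrack_rev s : no_backtrack Y s -> no_backtrack Y (rev_walk s).
Proof.
elim: s => [|e s ih] //; case: s ih => [|f s] ih //= [fe h].
rewrite !rev_walk_cons -[rcons (rcons _ _) _]cats1.
apply: no_backtrack_cat => //; first by rewrite -rev_walk_cons; exact: ih.
by rewrite einvK => ef; exact: fe (esym ef).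
Qed.

(** Follow one reduced walk backwards and then the other: where they part, the
    closed walk so obtained has no backtracking. *)
Lemma reduced_walk_unique u v s s' : is_tree Y -> walk Y u s v ->
  walk Y u s' v -> no_backtrack Y s -> no_backtrack Y s' -> s = s'.
Proof.
move=> [_ _ loops]; elim: s u s' => [|e s ih] u s'.
  by move=> /= -> ws' _ ns'; rewrite (loops _ _ ws' ns').
case: s' => [|f s'] ws ws' ns ns'.
  by move: ws' ws => /= <- ws; exact: (loops u (e :: s) ws ns).
have [ef|ef] := pselect (e = f).
  subst f; move: ws ws' ns ns' => [_ ws] [_ ws'] [_ ns] [_ ns'].
  by rewrite (ih _ _ ws ws' ns ns').
have := loops _ _ (walk_cat (walk_rev ws) ws').
rewrite rev_walk_cons => h; exfalso.
have : no_backtrack Y (rcons (rev_walk s) (einv Y e) ++ f :: s').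
  apply: no_backtrack_cat => //; last by rewrite einvK; exact: nesym.
  by rewrite -rev_walk_cons; exact: no_backtrack_rev.
by move/h => /(congr1 size); rewrite size_cat addnS.
Qed.

End Walks.

Section ActionLemmas.
Context {G : groupType} {H : set G} (T : tree_action H).
Hypothesis subH : is_subgroup H.
Implicit Types (g h : G) (x : tvert T) (e f : tedge T).
Local Open Scope group_scope.

Lemma act_ter g e : H g -> ter (tgraph T) (actE g e) = actV g (ter (tgraph T) e).
Proof. by move=> Hg; rewrite /ter act_einv // act_org. Qed.

Lemma actEK g e : H g -> actE g^-1 (actE g e) = e.
Proof.
have [_ _ HV] := subH.
by move=> Hg; rewrite -actEM ?mulVg ?actE1 //; exact: HV.
Qed.

Lemma actE_inj g e f : H g -> actE g e = actE g f -> e = f.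
Proof. by move=> Hg ef; rewrite -(actEK e Hg) ef actEK. Qed.

Lemma stabE_subgroup e : is_subgroup (stabE e).
Proof.
have [H1 HM HV] := subH; split.
- by split => //=; rewrite actE1.
- move=> g h [Hg /= ge] [Hh /= he]; split; first exact: HM.
  by rewrite /= actEM // he.
- move=> g [Hg /= ge]; split; first exact: HV.
  by rewrite /= -{1}ge actEK.
Qed.

Lemma stabV_subgroup x : is_subgroup (stabV x).
Proof.
have [H1 HM HV] := subH; split.
- by split => //=; rewrite actV1.
- move=> g h [Hg /= ge] [Hh /= he]; split; first exact: HM.
  by rewrite /= actVM // he.
- move=> g [Hg /= ge]; split; first exact: HV.
  by rewrite /= -{1}ge -actVM ?mulVg ?actV1 //; exact: HV.
Qed.

Lemma left_coset_absorb K g h : is_subgroup K -> K h ->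
  left_coset (g * h) K = left_coset g K :> set G.
Proof.
move=> [_ KM KV] Kh; apply/seteqP; split=> _ [k Kk <-].
  by exists (h * k); [exact: KM | rewrite mulgA].
exists (h^-1 * k); last by rewrite mulgA mulgK.
by apply: (KM) => //; exact: KV.
Qed.

End ActionLemmas.

Section Words.
Context {R : realType} {X : metricType R} {H : set (isom X)} {D : gog H}.
Context {L : gog_lifts D} {C : {set gedge D}} (S : hyp_choice L C).
Hypothesis subH : is_subgroup H.
Local Open Scope group_scope.
Local Notation Y := (ggraph D).
Local Notation letter := (gedge D * set (isom X))%type.
Implicit Types (e f : gedge D) (c : set (isom X)) (g h q : isom X).
Implicit Types (w : seq letter).

Fixpoint transition_word e w : Prop :=
  if w is (f, c) :: w' then
    [/\ f \in C, c \in selected S e f & transition_word f w']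
  else True.

Fixpoint word_product e w : isom X :=
  if w is (f, c) :: w' then hrep S e f c * word_product f w' else 1.

(** The edges of the Bass-Serre tree travelled through by [w], starting at the
    translate by [g] of the lift of the terminus of [e]. *)
Fixpoint word_path g e w : seq (tedge D) :=
  if w is (f, c) :: w' then
    actE (g * hrep S e f c * (tau L f)^-1) (liftE L f) ::
      word_path (g * hrep S e f c) f w'
  else [::].

Definition last_edge e w : gedge D := last e [seq fc.1 | fc <- w].

(** A chosen representative is [q * tau], where [q] carries the lift of [f] to
    the edge labelled by the coset. *)
Lemma hrep_coset e f c : e \in C -> f \in C -> c \in selected S e f ->
  exists q, [/\ H q, actV q (liftV L (org Y f)) = liftV L (org Y f),
    hrep S e f c = q * tau L f & c = left_coset q (egroup L f)].
Proof.
have [_ HM _] := subH.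
move=> eC fC cS; have [r [h [[Hr /= rv] -> [Hh /= he] ->]]] := hrepP eC fC cS.
exists (r * h); split => //; first exact: HM.
  by rewrite actVM // -{1}(liftE_org L) -act_org // he liftE_org.
by rewrite left_coset_absorb //; exact: stabE_subgroup.
Qed.

Lemma hrep_in e f c : e \in C -> f \in C -> c \in selected S e f ->
  H (hrep S e f c).
Proof.
have [_ HM _] := subH.
move=> eC fC cS; have [q [Hq _ -> _]] := hrep_coset eC fC cS.
by apply: (HM) => //; exact: tau_in.
Qed.

Lemma word_product_in e w : e \in C -> transition_word e w ->
  H (word_product e w).
Proof.
have [H1 HM _] := subH.
elim: w e => [|[f c] w ih] e eC //= [fC cS tw].
by apply: (HM); [exact: hrep_in | exact: ih].
Qed.

Lemma projE_act g x : H g -> projE (actE g x) = projE x :> gedge D.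
Proof. by move=> Hg; apply/esym/projE_orbit; exists g. Qed.

Lemma word_path_walk g e w : H g -> e \in C -> transition_word e w ->
  walk (tgraph D) (actV g (liftV L (ter Y e))) (word_path g e w)
    (actV (g * word_product e w) (liftV L (ter Y (last_edge e w)))).
Proof.
have [_ HM HV] := subH.
elim: w g e => [|[f c] w ih] g e Hg eC; first by rewrite /= mulg1.
move=> /= [fC cS tw].
have [q [Hq qv kE _]] := hrep_coset eC fC cS; have Ht := tau_in L f.
have [ef _ _] := selectedP eC fC cS.
have Hgq := HM _ _ Hg Hq.
rewrite kE !mulgA mulgK; split.
  by rewrite act_org // liftE_org actVM // qv ef.
rewrite act_ter // tau_ter -actVM //.
by apply: ih => //; exact: HM.
Qed.

(** A backtracking would make the second of two successive cosets trivial,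
    which is what the definition of allowed transitions excludes. *)
Lemma word_path_reduced g e w : H g -> e \in C -> transition_word e w ->
  no_backtrack (tgraph D) (word_path g e w).
Proof.
have [_ HM HV] := subH.
elim: w g e => [|[f c] w ih] g e Hg eC //= [fC cS tw].
have [q [Hq qv kE _]] := hrep_coset eC fC cS; have Ht := tau_in L f.
have Hgq := HM _ _ Hg Hq; have Hgk := HM _ _ Hg (hrep_in eC fC cS).
split; last exact: ih.
case: w tw {ih} => [|[f' c'] w] //= [fC' cS' _] bt.
have [q' [Hq' _ kE' cE']] := hrep_coset fC fC' cS'.
rewrite act_einv in bt; last by apply: (HM) => //; exact: HV.
have Hgkq := HM _ _ Hgk Hq'.
have lift_inv : actE (g * hrep S e f c * (tau L f)^-1) (einv (tgraph D) (liftE L f)) =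
    actE (g * hrep S e f c) (liftE L (einv Y f)).
  by rewrite liftE_einv actEM //; exact: HV.
rewrite lift_inv kE' mulgA mulgK in bt.
have ff' : f' = einv Y f.
  by have := congr1 (@projE _ _ D) bt; rewrite !projE_act // !liftEK.
rewrite -ff' actEM // in bt; have stab := actE_inj subH Hgk bt.
have [_ _ /(_ ff')] := selectedP fC fC' cS'; apply.
have [E1 _ _] := stabE_subgroup subH (liftE L f').
by rewrite cE' -[q']mul1g left_coset_absorb //; [
  apply/seteqP; split => [_ [k kE1 <-]|k kE1]; rewrite ?mul1g //; exists k; rewrite ?mul1g
  | exact: stabE_subgroup].
Qed.

(** An edge of the path determines its image in the quotient graph and the
    coset by which the lift of this image has been translated. *)
Lemma word_path_inj g e w w' : H g -> e \in C -> transition_word e w ->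
  transition_word e w' -> word_path g e w = word_path g e w' -> w = w'.
Proof.
have [_ HM HV] := subH.
elim: w w' g e => [|[f c] w ih] [|[f' c'] w'] g e Hg eC //=.
move=> [fC cS tw] [fC' cS' tw'] [].
have [q [Hq _ kE cE]] := hrep_coset eC fC cS.
have [q' [Hq' _ kE' cE']] := hrep_coset eC fC' cS'.
rewrite {1}kE {1}kE' !mulgA !mulgK => e1.
have Hgq := HM _ _ Hg Hq; have Hgq' := HM _ _ Hg Hq'.
have ff' : f = f'.
  by have := congr1 (@projE _ _ D) e1; rewrite !projE_act // !liftEK.
subst f'; rewrite !actEM // in e1; have {}e1 := actE_inj subH Hg e1.
have cc' : c = c'.
  have st : egroup L f (q^-1 * q').
    have HVq := HV _ Hq; split; first exact: HM.
    by rewrite /= actEM // -e1 actEK.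
  by rewrite cE cE' -[q'](mulVKg q) left_coset_absorb //; exact: stabE_subgroup.
move=> e2; rewrite -cc' in e2 *; congr (_ :: _).
apply: (ih _ _ _ _ fC tw tw' e2).
by apply: (HM) => //; exact: hrep_in.
Qed.

(** The product of a word determines the end of its path in the Bass-Serre
    tree, hence the path. *)
Lemma word_product_inj e w w' : e \in C -> transition_word e w ->
  transition_word e w' -> last_edge e w = last_edge e w' ->
  word_product e w = word_product e w' -> w = w'.
Proof.
have [H1 _ _] := subH.
move=> eC tw tw' el ep; apply: (word_path_inj H1 eC tw tw').
apply: (reduced_walk_unique (tgraph_tree D) (word_path_walk H1 eC tw)).
- by rewrite ep el; exact: word_path_walk.
- exact: word_path_reduced.
- exact: word_path_reduced.
Qed.

End Words.

(** * Transition matrices *)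

Import ComplexField.Normc.

Section PathMass.
Context {R : realType} {E : finType} (C : {set E}).
Implicit Types (M : E -> E -> R) (e f : E) (p : seq E) (K Q a : R).

(** The row sums of the [n]-th power of the block matrix of [M]. *)
Fixpoint path_mass M n e : R :=
  if n is n'.+1 then \sum_(f in C) M e f * path_mass M n' f else 1.

Lemma path_mass_ge0 M n e : (forall e f, 0 <= M e f) -> 0 <= path_mass M n e.
Proof.
by move=> M0; elim: n e => //= n ih e; apply: sumr_ge0 => f _; rewrite mulr_ge0.
Qed.

Fixpoint path_product M e p : R :=
  if p is f :: p' then M e f * path_product M f p' else 1.

Lemma path_product_mass_le M n e p : (forall e f, 0 <= M e f) ->
  {subset p <= C} ->
  path_product M e p * path_mass M n (last e p) <= path_mass M (size p + n) e.
Proof.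
move=> M0; elim: p e => [|f p ih] e pC /=; first by rewrite mul1r.
have fC : f \in C by apply: pC; rewrite mem_head.
rewrite (bigD1 f) //= -mulrA; apply: le_trans (ler_wpM2l (M0 e f) (ih f _)) _.
  by move=> g gp; apply: pC; rewrite inE gp orbT.
by rewrite lerDl sumr_ge0 // => g _; rewrite mulr_ge0 // path_mass_ge0.
Qed.

Lemma path_product_zip M e f p :
  path_product M e (rcons p f) =
  \prod_(ef <- zip (e :: p) (rcons p f)) M ef.1 ef.2.
Proof.
elim: p e => [|g p ih] e /=; first by rewrite big_cons big_nil.
by rewrite ih big_cons.
Qed.

Lemma le_of_exprn_le K Q a : 0 <= a -> 0 < Q ->
  (forall n, a ^+ n <= K * Q ^+ n) -> a <= Q.
Proof.
move=> a0 Q0 h; rewrite leNgt; apply/negP => Qa.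
have ap := lt_trans Q0 Qa.
have K1 : 1 <= K by have := h 0%N; rewrite !expr0 mulr1.
have q0 : 0 < Q / a by rewrite divr_gt0.
have [||n _ hn] := @cvg_expr R (Q / a) _ [set z | `|0 - z| < K^-1].
- by rewrite gtr0_norm // ltr_pdivrMr // mul1r.
- by apply: nbhsx_ballx; rewrite invr_gt0 (lt_le_trans ltr01).
have := hn n (leqnn n); rewrite /= sub0r normrN gtr0_norm ?exprn_gt0 //.
rewrite expr_div_n ltr_pdivrMr ?exprn_gt0 // => /lt_le_trans-/(_ _ (_ : _ <= Q ^+ n)).
rewrite ltxx => hq; suff : false by []; apply: hq.
by rewrite mulrC ler_pdivrMr ?(lt_le_trans ltr01) // mulrC.
Qed.

Lemma normc_sum (I : Type) (r : seq I) (F : I -> R[i]) :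
  normc (\sum_(i <- r) F i) <= \sum_(i <- r) normc (F i).
Proof.
elim/big_ind2: _ => [|x1 x2 y1 y2 h1 h2|//]; first by rewrite normc0.
by apply: le_trans (le_normcD _ _) _; exact: lerD.
Qed.

Lemma normc_ge0 (z : R[i]) : 0 <= normc z.
Proof. by case: z => x y; exact: sqrtr_ge0. Qed.

(** For a row eigenvector [v] of eigenvalue [z], the sum of the [normc (v i)]
    is multiplied by at least [normc z] under the transposed action of the
    nonnegative matrix; iterate and compare with the row sums. *)
Lemma spectral_radius_le M K Q : (forall e f, 0 <= M e f) -> 0 < Q ->
  (forall n e, e \in C -> path_mass M n e <= K * Q ^+ n) ->
  spectral_radius (block_matrix C M) <= Q.
Proof.
move=> M0 Q0 hM; rewrite /spectral_radius; set A := [set _ | _ in _].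
have [->|/set0P A0] := eqVneq A set0; first by rewrite sup0 ltW.
apply: ge_sup => // _ [z /= /eigenvalueP[v vM v0] <-].
pose nv i := normc (v 0 i); pose nz := normc z.
have nv0 i : 0 <= nv i by exact: normc_ge0.
have nz0 : 0 <= nz by exact: normc_ge0.
have step j : nz * nv j <= \sum_i nv i * M (enum_val i) (enum_val j).
  rewrite /nz /nv -normcM; move/rowP: vM => /(_ j); rewrite !mxE => <-.
  apply: le_trans (normc_sum _ _) _; apply: ler_sum => i _.
  rewrite normcM !mxE ler_wpM2l ?normc_ge0 //.
  by rewrite /normc /= expr0n addr0 sqrtr_sqr ger0_norm.
have iterate n : nz ^+ n * \sum_j nv j <= \sum_i nv i * path_mass M n (enum_val i).
  elim: n => [|n ih]; first by rewrite expr0 mul1r; apply: ler_sum => i _; rewrite mulr1.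
  rewrite exprS -mulrA; apply: le_trans (ler_wpM2l nz0 ih) _.
  rewrite mulr_sumr.
  apply: le_trans (_ : \sum_i (\sum_k nv k * M (enum_val k) (enum_val i)) *
      path_mass M n (enum_val i) <= _).
    by apply: ler_sum => i _; rewrite mulrA ler_wpM2r // path_mass_ge0.
  under eq_bigr do rewrite mulr_suml.
  rewrite exchange_big /=; apply: ler_sum => k _.
  rewrite [X in _ * X]big_enum_val mulr_sumr; apply: ler_sum => i _.
  by rewrite mulrA.
have nv_gt0 : 0 < \sum_j nv j.
  rewrite lt_neqAle sumr_ge0 // andbT eq_sym; apply: contraNneq v0 => s0.
  apply/eqP/rowP => j; rewrite mxE; apply: eq0_normc; apply/eqP.
  by rewrite eq_le nv0 andbT -s0 (bigD1 j) //= lerDl sumr_ge0.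
apply: (le_of_exprn_le (K := K)) => // n.
rewrite -(ler_pM2r nv_gt0); apply: le_trans (iterate n) _.
rewrite mulr_sumr; apply: ler_sum => i _; rewrite mulrC ler_wpM2r //.
by apply: hM; exact: enum_valP.
Qed.

(** Going [m] times around a cycle shows that the product of the entries along
    it cannot exceed one when the row sums stay bounded. *)
Lemma cycle_product_le1 M K e p : (forall e f, 0 <= M e f) ->
  {subset e :: p <= C} -> (forall n, path_mass M n e <= K) ->
  path_product M e (rcons p e) <= 1.
Proof.
move=> M0 pC hK.
have pC' : {subset rcons p e <= C} by move=> f; rewrite mem_rcons; exact: pC.
have P0 q f : 0 <= path_product M f q.
  by elim: q f => //= g q ih f; rewrite mulr_ge0.
apply: (le_of_exprn_le (K := K)) => // m; rewrite expr1n mulr1.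
apply: le_trans (hK (m * size (rcons p e))%N).
elim: m => [|m ih] //=.
rewrite exprS mulSn; apply: le_trans (path_product_mass_le _ e M0 pC').
by rewrite last_rcons ler_wpM2l.
Qed.

End PathMass.

(** * Counting words in the orbit *)

Section Counting.
Context {R : realType} {X : metricType R} {H : set (isom X)} {D : gog H}.
Context {L : gog_lifts D} {C : {set gedge D}} (S : hyp_choice L C).
Variables (Gam : set (isom X)) (o : X) (Rb : gedge D -> gedge D -> R).
Hypotheses (subH : is_subgroup H) (HG : H `<=` Gam).
Hypotheses (cat : cat_minus_one X) (bound : length_bound S o Rb).
Local Notation letter := (gedge D * set (isom X))%type.
Implicit Types (e f : gedge D) (w : seq letter).

Definition letters e : seq letter :=
  [seq (f, c) | f <- enum C, c <- enum_fset (selected S e f)].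

Fixpoint words n e : seq (seq letter) :=
  if n is n'.+1 then [seq x :: w | x <- letters e, w <- words n' x.1]
  else [:: [::]].

Lemma letters_uniq e : uniq (letters e).
Proof.
apply: allpairs_uniq_dep; first exact: enum_uniq.
- by move=> f _; exact: fset_uniq.
- by move=> [f c] [f' c'] _ _ /= [ff' cc']; subst f' c'.
Qed.

Lemma words_uniq n e : uniq (words n e).
Proof.
elim: n e => //= n ih e; apply: allpairs_uniq_dep; first exact: letters_uniq.
- by move=> x _; exact: ih.
- by move=> [x w] [x' w'] _ _ /= [xx' ww']; subst x' w'.
Qed.

Lemma words_transition n e w : w \in words n e ->
  transition_word S e w /\ size w = n.
Proof.
elim: n e w => [|n ih] e w; first by rewrite inE => /eqP->.
move=> /allpairsPdep[x [w' [/allpairsPdep[f [c [fC cS ->]]] ww' ->]]].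
have [tw sw] := ih _ _ ww'; split; last by rewrite /= sw.
by split => //; rewrite mem_enum in fC.
Qed.

Fixpoint word_weight (q : gedge D -> gedge D -> R) e w : R :=
  if w is x :: w' then q e x.1 * word_weight q x.1 w' else 1.

Lemma path_mass_words M q n e :
  (forall e f, e \in C -> f \in C -> M e f = nsel S e f * q e f) -> e \in C ->
  path_mass C M n e = \sum_(w <- words n e) word_weight q e w.
Proof.
move=> MS; elim: n e => [|n ih] e eC; first by rewrite big_seq1.
rewrite [RHS]big_allpairs_dep /= big_allpairs_dep /= big_enum /=.
apply: eq_bigr => f fC.
rewrite (eq_bigr (fun=> q e f * path_mass C M n f)); last first.
  by move=> c _; rewrite -mulr_sumr ih.
by rewrite big_const_seq iter_addr_0 count_predT MS // -mulrA mulr_natl.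
Qed.

Lemma retained_disp e f c : e \in C -> f \in C -> c \in selected S e f ->
  mdist o (hrep S e f c o) <= Rb e f.
Proof.
move=> eC fC cS.
apply: le_trans (displacement_le_axis_length o cat (hrep_hyperbolic eC fC cS)) _.
apply: bound => //; rewrite /retained eC fC /=.
by apply/eqP => S0; rewrite S0 in cS.
Qed.

(** The slack [kappa] per letter is zero for cycles; it absorbs the uniform bound
    on [Rb] in the case of the matrix of multiplicities, and the difference of
    [s] and the critical exponent in the case of [B]. *)
Lemma word_weight_le q (kappa s : R) e w : 0 <= s ->
  (forall e f, 0 <= q e f) ->
  (forall e f, retained S e f -> q e f <= expR (kappa - s * Rb e f)) ->
  e \in C -> transition_word S e w ->
  word_weight q e w <=
    expR kappa ^+ size w * expR (- (s * mdist o (word_product S e w o))).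
Proof.
move=> s0 q0 hq; elim: w e => [|[f c] w ih] e eC /=.
  by move=> _; rewrite mdistxx mulr0 oppr0 expR0 mulr1.
move=> [fC cS tw].
have ret : retained S e f.
  by rewrite /retained eC fC; apply/eqP => S0; rewrite S0 in cS.
apply: le_trans (ler_wpM2l (q0 e f) (ih f fC tw)) _.
rewrite exprS [leLHS]mulrCA [leRHS]mulrAC [leRHS]mulrC ler_wpM2l ?exprn_ge0 ?expR_ge0 //.
apply: le_trans (ler_wpM2r (expR_ge0 _) (hq e f ret)) _.
rewrite -!expRD ler_expR.
have h1 := retained_disp eC fC cS.
have h2 := metric_triangle o (hrep S e f c o) (hrep S e f c (word_product S f w o)).
rewrite isom_dist in h2.
have := ler_wpM2l s0 h1; have := ler_wpM2l s0 h2; rewrite !mulrDr; lra.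
Qed.

(** Words with the same last edge have different products, so that each value
    of the last edge contributes at most the Poincare series. *)
Lemma path_mass_le M q (kappa s : R) n e : 0 <= s ->
  (poincare Gam o s < +oo)%E ->
  (forall e f, e \in C -> f \in C -> M e f = nsel S e f * q e f) ->
  (forall e f, 0 <= q e f) ->
  (forall e f, retained S e f -> q e f <= expR (kappa - s * Rb e f)) ->
  e \in C ->
  path_mass C M n e <=
    #|gedge D|%:R * fine (poincare Gam o s) * expR kappa ^+ n.
Proof.
move=> s0 ps MS q0 hq eC; rewrite (path_mass_words n MS eC).
pose term w := expR (- (s * mdist o (word_product S e w o))).
apply: le_trans (_ : \sum_(w <- words n e) expR kappa ^+ n * term w <= _).
  rewrite big_seq [leRHS]big_seq; apply: ler_sum => w /words_transition[tw <-].
  exact: word_weight_le.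
rewrite -mulr_sumr mulrC ler_wpM2r ?exprn_ge0 ?expR_ge0 //.
rewrite (partition_big (fun w => last_edge e w) predT) //=.
rewrite mulr_natl -sumr_const; apply: ler_sum => f _.
have p0 : (0 <= poincare Gam o s)%E.
  by apply: esum_ge0 => g _; rewrite lee_fin expR_ge0.
rewrite -big_filter -lee_fin fineK ?ge0_fin_numE //.
set l := [seq w <- _ | _].
have hl w : w \in l -> transition_word S e w /\ last_edge e w = f.
  by rewrite mem_filter => /andP[/eqP lf /words_transition[tw _]].
rewrite -(big_map (fun w => word_product S e w) predT
  (fun g : isom X => expR (- (s * mdist o (g o))))).
apply: poincare_sum_le.
  rewrite map_inj_in_uniq ?filter_uniq ?words_uniq //.
  move=> w w' /hl[tw lw] /hl[tw' lw'] ww'.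
  by apply: word_product_inj ww' => //; rewrite lw.
move=> _ /mapP[w /hl[tw _] ->]; apply: HG.
exact: word_product_in.
Qed.

End Counting.

Lemma le_mul_of_gt (R : realType) (d x r : R) :
  (forall s, d < s -> x <= s * r) -> x <= d * r.
Proof.
move=> h; rewrite leNgt; apply/negP => hx.
pose s := d + (x - d * r) / (2 * (`|r| + 1)).
have r0 : 0 < 2 * (`|r| + 1) by rewrite mulr_gt0 // ltr_wpDl.
have ds : d < s by rewrite /s ltrDl divr_gt0 // subr_gt0.
have := h s ds; apply/negP; rewrite -ltNge /s mulrDl.
have e0 : 0 < x - d * r by rewrite subr_gt0.
have : (x - d * r) / (2 * (`|r| + 1)) * r < x - d * r.
  rewrite mulrAC ltr_pdivrMr // ltr_pM2l //.
  by have := ler_norm r; have := normr_ge0 r; lra.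
lra.
Qed.

Section Growth.
Context {R : realType} {X : metricType R}.
Variables (Gam : set (isom X)) (o : X).
Hypotheses (cat : cat_minus_one X).
Hypotheses (pos : (0 < critical_exponent Gam o)%E).
Hypotheses (finG : (critical_exponent Gam o < +oo)%E).
Context {H : set (isom X)} {D : gog H}.
Context {L : gog_lifts D} {C : {set gedge D}} (S : hyp_choice L C).
Variables (Rb : gedge D -> gedge D -> R).
Hypotheses (subH : is_subgroup H) (HG : H `<=` Gam).
Hypothesis (bound : length_bound S o Rb).

Let delta : R := fine (critical_exponent Gam o).

Lemma critical_exponent_fin : critical_exponent Gam o = delta%:E.
Proof. by rewrite /delta fineK // ge0_fin_numE // ltW. Qed.

Lemma delta_gt0 : 0 < delta.
Proof. by rewrite -lte_fin -critical_exponent_fin. Qed.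

Lemma poincare_above_delta s : delta < s -> (poincare Gam o s < +oo)%E.
Proof. by move=> ds; apply: poincare_above; rewrite critical_exponent_fin lte_fin. Qed.

Lemma retained_Rb_ge0 e f : retained S e f -> 0 <= Rb e f.
Proof.
move=> /and3P[eC fC /fset0Pn[c cS]].
exact: le_trans (mdist_ge0 _ _) (retained_disp cat bound eC fC cS).
Qed.

Lemma rho_B_le1 : rho_B S Rb delta <= 1.
Proof.
rewrite leNgt; apply/negP => rho1.
pose r := \sum_(e : gedge D) \sum_(f : gedge D) `|Rb e f|.
have Rr e f : Rb e f <= r.
  apply: le_trans (ler_norm _) _; rewrite /r (bigD1 e) //= (bigD1 f) //=.
  rewrite -addrA lerDl addr_ge0 ?sumr_ge0 // => g _.
  by apply: sumr_ge0.
have rho0 := lt_trans ltr01 rho1.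
suff : ln (rho_B S Rb delta) + delta * r <= delta * r.
  by rewrite -lerBrDr subrr leNgt ln_gt0.
apply: le_mul_of_gt => s ds.
have s0 : 0 <= s by have := delta_gt0; lra.
suff h : rho_B S Rb delta <= expR ((s - delta) * r).
  by rewrite -lerBrDr -mulrBl -[leRHS]expRK ler_ln ?posrE ?expR_gt0.
apply: (spectral_radius_le (K := #|gedge D|%:R * fine (poincare Gam o s))) => //.
- by move=> e f; rewrite mulr_ge0 ?expR_ge0.
- exact: expR_gt0.
move=> n e eC; apply: (path_mass_le subH HG cat bound (q := fun e f => expR (- (delta * Rb e f)))) => //.
- exact: poincare_above_delta.
move=> e' f' ret; rewrite ler_expR; have := Rr e' f'.
have := retained_Rb_ge0 ret; nra.
Qed.

Lemma uniform_bound_delta : uniform_bound S Rb (critical_exponent Gam o).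
Proof.
move=> R0 hR rho1; rewrite critical_exponent_fin -EFinM lee_fin.
have rho0 := lt_trans ltr01 rho1.
apply: le_mul_of_gt => s ds.
have s0 : 0 <= s by have := delta_gt0; lra.
suff h : rho_N S <= expR (s * R0).
  by rewrite -[leRHS]expRK ler_ln ?posrE ?expR_gt0.
apply: (spectral_radius_le (K := #|gedge D|%:R * fine (poincare Gam o s))) => //.
- exact: expR_gt0.
move=> n e eC; apply: (path_mass_le subH HG cat bound (q := fun _ _ => 1)) => //.
- exact: poincare_above_delta.
- by move=> ? ? _ _; rewrite mulr1.
move=> e' f' ret; rewrite -expR0 ler_expR subr_ge0.
by apply: ler_wpM2l => //; exact: hR.
Qed.

Lemma path_zip (T : Type) (r : rel T) x y (p : seq T) :
  path r x (rcons p y) = all (fun z => r z.1 z.2) (zip (x :: p) (rcons p y)).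
Proof. by elim: p x => [|z p ih] x //=; rewrite ih. Qed.

Lemma cycle_bound_delta : cycle_bound S Rb (critical_exponent Gam o).
Proof.
case=> [|e p] // _ cyc; rewrite critical_exponent_fin -EFinM lee_fin.
have zE : zip (e :: p) (rot 1 (e :: p)) = zip (e :: p) (rcons p e).
  by rewrite rot1_cons.
rewrite zE; apply: le_mul_of_gt => s ds.
have s0 : 0 <= s by have := delta_gt0; lra.
pose M e f := nsel S e f * expR (- (s * Rb e f)).
have M0 e' f' : 0 <= M e' f' by rewrite mulr_ge0 ?expR_ge0.
have pC : {subset e :: p <= C}.
  have retC x q : path (retained S) x q -> {subset q <= C}.
    elim: q x => [|y q ih] x //= /andP[/and3P[_ yC _] /ih qC] z.
    by rewrite inE => /orP[/eqP->//|/qC].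
  by move=> f fp; apply: (retC _ _ cyc); rewrite mem_rcons.
have eC := pC e (mem_head _ _).
have := cycle_product_le1 (K := #|gedge D|%:R * fine (poincare Gam o s)) M0 pC.
rewrite path_product_zip => /(_ _) h.
have {}h : \prod_(ef <- zip (e :: p) (rcons p e)) M ef.1 ef.2 <= 1.
  apply: h => n.
  have := path_mass_le subH HG cat bound (q := fun e f => expR (- (s * Rb e f)))
    (kappa := 0) n s0 (poincare_above_delta ds) (M := M).
  rewrite expR0 expr1n mulr1; apply => //.
  by move=> e' f' _; rewrite sub0r.
have ret : all (fun z => retained S z.1 z.2) (zip (e :: p) (rcons p e)).
  by rewrite -path_zip.
have e1 : \prod_(ef <- zip (e :: p) (rcons p e)) M ef.1 ef.2 =
    expR (\sum_(ef <- zip (e :: p) (rcons p e)) (ln (nsel S ef.1 ef.2) - s * Rb ef.1 ef.2)).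
  rewrite (big_morph expR (@expRD R) (@expR0 R)).
  rewrite big_seq [RHS]big_seq; apply: eq_bigr => ef /(allP ret) rf.
  rewrite expRD lnK // posrE ltr0n cardfs_gt0.
  by case/and3P: rf.
move: h; rewrite e1 -[leRHS]expR0 ler_expR sumrB -mulr_sumr; lra.
Qed.

Lemma uniform_bound_le (kappa : \bar R) :
  (critical_exponent Gam o <= kappa)%E -> uniform_bound S Rb kappa.
Proof.
move=> dk R0 hR rho1; have h := uniform_bound_delta hR rho1.
apply: le_trans h _; apply: lee_wpmul2r => //; rewrite lee_fin.
have := uniform_bound_delta hR rho1.
rewrite critical_exponent_fin -EFinM lee_fin => h.
have := ln_gt0 rho1; have := delta_gt0; nra.
Qed.

Lemma cycle_bound_le (kappa : \bar R) :
  (critical_exponent Gam o <= kappa)%E -> cycle_bound S Rb kappa.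
Proof.
move=> dk w w0 cyc; apply: le_trans (cycle_bound_delta w0 cyc) _.
apply: lee_wpmul2r => //; rewrite lee_fin.
case: w w0 cyc => [|e p] // _ cyc.
have zE : zip (e :: p) (rot 1 (e :: p)) = zip (e :: p) (rcons p e).
  by rewrite rot1_cons.
rewrite zE big_seq; apply: sumr_ge0 => ef.
have ret : all (fun z => retained S z.1 z.2) (zip (e :: p) (rcons p e)).
  by rewrite -path_zip.
by move=> /(allP ret); exact: retained_Rb_ge0.
Qed.

End Growth.

Lemma every_node_subgroup (G : groupType) (Gam : set G)
    (P : forall H : set G, gog H -> Prop) :
  (forall (H : set G) (D : gog H), is_subgroup H -> H `<=` Gam -> P H D) ->
  forall (H : set G) (T : hierarchy H), is_subgroup H -> H `<=` Gam ->
    every_node P T.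
Proof.
move=> hP H; elim=> {H} [//|H D sel x xK children ih] subH HG /=.
split; first exact: hP.
move=> v hv; apply: ih; first exact: stabV_subgroup.
by move=> g [Hg _]; exact: HG.
Qed.

Theorem corollary1p11 (R : realType) (X : metricType R)
    (Gam : set (isom X)) (A B : boundary X) (o : X) :
  proper_space X -> cat_minus_one X ->
  is_subgroup Gam -> finitely_generated Gam ->
  non_elementary Gam o -> discrete_group Gam ->
  (0 < critical_exponent Gam o)%E -> (critical_exponent Gam o < +oo)%E ->
  limit_set Gam o A -> limit_set Gam o B -> A <> B -> on_geodesic A B o ->
  let delta := critical_exponent Gam o in
  let dimL := hausdorff_dim (bourdon_metric o) (limit_set Gam o) in
  (forall (H : set (isom X)) (D : gog H) (L : gog_lifts D)
      (C : {set gedge D}) (S : hyp_choice L C) (Rb : gedge D -> gedge D -> R),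
    is_subgroup H -> H `<=` Gam -> is_block L C -> length_bound S o Rb ->
    [/\ rho_B S Rb (fine delta) <= 1,
        uniform_bound S Rb delta,
        cycle_bound S Rb delta &
        (delta < 1)%E \/ convex_cobounded Gam o ->
          uniform_bound S Rb dimL /\ cycle_bound S Rb dimL]) /\
  ((delta < 1)%E \/ convex_cobounded Gam o ->
    forall T : hierarchy Gam, grushko_jsj T ->
      every_node (fun (H : set (isom X)) (D : gog H) =>
        forall (L : gog_lifts D) (C : {set gedge D}) (S : hyp_choice L C)
          (Rb : gedge D -> gedge D -> R),
          is_block L C -> length_bound S o Rb ->
          uniform_bound S Rb dimL /\ cycle_bound S Rb dimL) T).
Proof.
move=> prop cat subG fgG neG _ pos finG lA lB AB _ delta dimL.
have le_dim : (delta <= dimL)%E.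
  exact: critical_exponent_le_dim cat prop subG fgG neG finG A B lA lB AB.
have dim_bounds (H : set (isom X)) (D : gog H) (L : gog_lifts D)
    (C : {set gedge D}) (S : hyp_choice L C) (Rb : gedge D -> gedge D -> R) :
    is_subgroup H -> H `<=` Gam -> length_bound S o Rb ->
    uniform_bound S Rb dimL /\ cycle_bound S Rb dimL.
  move=> subH HG bound; split.
    exact: (uniform_bound_le cat pos finG subH HG bound le_dim).
  exact: (cycle_bound_le cat pos finG subH HG bound le_dim).
split=> [H D L C S Rb subH HG _ bound|_ T _].
  split; first exact: (rho_B_le1 cat pos finG subH HG bound).
  - exact: (uniform_bound_delta cat pos finG subH HG bound).
  - exact: (cycle_bound_delta cat pos finG subH HG bound).
  - by move=> _; exact: dim_bounds.
apply: (every_node_subgroup (Gam := Gam)) => // H D subH HG L C S Rb _ bound.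
exact: dim_bounds.
Qed.
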